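(* Let $l \ge 1$ and $k \ge l$ be integers. Consider the tiny-tasks split-merge system with $l$ workers and $k$ tasks per job, with job arrival times $A(n)$, departure times $D(n)$, task service times $Q_i(n)$ ($i\in[1,k]$, $n\ge 1$) and job service times $\Delta(n)$. Then the system is a max-plus server with service process $S(m,n) = \sum_{\nu=m}^{n} \Delta(\nu)$, i.e., for all $n \ge 1$, $$D(n) \le \max_{m \in [1,n]} \{ A(m) + S(m,n) \}.$$ If moreover the task service times $Q_i(n)$, $i \in [1,k]$, $n \ge 1$, are iid exponential with parameter $\mu>0$, then for $\theta \in (0,\mu)$ the service process $S(m,n)$ has envelope rate $$\rho_S(\theta) = \rho_X(\theta) + (k-l)\,\rho_Z(\theta),$$ where $$\rho_X(\theta) = \frac{1}{\theta} \sum_{i=1}^l \ln \left( \frac{i \mu}{i \mu - \theta} \right) \quad \text{for } \theta \in (0,\mu), \qquad \rho_Z(\theta) = \frac{1}{\theta} \ln \left( \frac{l \mu}{l \mu - \theta} \right) \quad \text{for } \theta \in (0,l\mu),$$ and the expected job service time is, for all $n\ge 1$, $$\mathsf{E}[\Delta(n)] = \frac{1}{\mu} \left(\frac{k}{l} + \sum_{i=2}^l \frac{1}{i} \right).$$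
   Context: Tiny-tasks split-merge system: there are $l$ identical workers (servers). Job $n \ge 1$ arrives at time $A(n)$, with $0 \le A(1) \le A(2) \le \dots$, and consists of $k \ge l$ tasks with nonnegative service times $Q_1(n),\dots,Q_k(n)$. Jobs are served one at a time in order of arrival. Job $n$ starts service at time $\max\{A(n), D(n-1)\}$, where $D(n)$ is the departure time of job $n$ and $D(0)=0$ by convention; at that instant all $l$ workers are idle. The tasks of the job are put in a FIFO task queue in the order $1,\dots,k$; the first $l$ tasks start immediately, one on each worker, and whenever a worker finishes a task it immediately fetches the head-of-line task from the queue, if any, and serves it without interruption. Job $n$ departs at the time $D(n)$ when all of its $k$ tasks have finished service. The job service time is $\Delta(n) = D(n) - \max\{A(n),D(n-1)\}$, the time between the start of the job's first task and the completion of all of its tasks. Max-plus server: a system with arrival times $A(n)$ and departure times $D(n)$ is an $S(m,n)$ server (with service process $S(m,n)$, $n\ge m\ge 1$) if $D(n) \le \max_{m \in [1,n]} \{ A(m) + S(m,n) \}$ for all $n \ge 1$. Envelope rate: the service process $S(m,n)$ has envelope rate $\rho_S(\theta)$ if for all $n \ge m \ge 1$ and all $\theta$ in the indicated range, $\mathsf{E}[e^{\theta S(m,n)}] \le e^{\theta \rho_S(\theta)(n-m+1)}$. $[a,b]$ denotes the integers from $a$ to $b$, and empty sums equal $0$. *)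

(* Defs.v *)
From HB Require Import structures.
From mathcomp Require Import all_boot all_order all_algebra finmap.
From mathcomp Require Import all_classical all_reals all_analysis.

Set Implicit Arguments.
Unset Strict Implicit.
Unset Printing Implicit Defensive.

Import Order.TTheory GRing.Theory Num.Theory.
Import numFieldNormedType.Exports.

Local Open Scope classical_set_scope.
Local Open Scope ring_scope.

(* Jobs are numbered from 1 by [nat]; index 0 only serves the convention
   D 0 = 0. The tasks 1, ..., k of a job and the workers 1, ..., l are
   numbered from 0 by ['I_k] and ['I_l]. *)

Section SplitMerge.
Context {R : realType} (l k : nat).

(* The instant at which worker [v] has finished all the tasks preceding task
   [i] that were given to it, and [t0] if there are none. *)
Definition free_time (t0 : R) (q : 'I_k -> R) (worker : 'I_k -> 'I_l)
    (start : 'I_k -> R) (v : 'I_l) (i : 'I_k) : R :=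
  \big[Num.max/t0]_(j < k | (j < i)%N && (worker j == v)) (start j + q j).

(* The tasks of a job started at [t0], with service times [q], are served by
   the workers [worker i] from the instants [start i] on. A task beyond the
   first [l] is fetched by a worker that is first to become free once all the
   preceding tasks are assigned; if several workers become free at the same
   instant, any of them may fetch the task. *)
Record fifo_schedule (t0 : R) (q : 'I_k -> R) (worker : 'I_k -> 'I_l)
    (start : 'I_k -> R) : Prop := FifoSchedule {
  first_tasks_start : forall i : 'I_k, (i < l)%N -> start i = t0 ;
  first_tasks_workers : forall i j : 'I_k, (i < l)%N -> (j < l)%N ->
    worker i = worker j -> i = j ;
  next_task_start : forall i : 'I_k, (l <= i)%N ->
    start i = free_time t0 q worker start (worker i) i ;
  next_task_earliest : forall (i : 'I_k) (v : 'I_l), (l <= i)%N ->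
    start i <= free_time t0 q worker start v i }.

Definition job_start (A D : nat -> R) (n : nat) : R := Num.max (A n) (D n.-1).

(* Job [n] departs when the last of its tasks is finished; the seed of the
   maximum is harmless, as no task finishes before the start of the job. *)
Definition job_departure (t0 : R) (q : 'I_k -> R) (d : R) : Prop :=
  exists (worker : 'I_k -> 'I_l) (start : 'I_k -> R),
    fifo_schedule t0 q worker start /\
    d = \big[Num.max/t0]_(i < k) (start i + q i).

(* [A n], [D n] and [Q i n] are one sample path of the arrival, departure and
   task service times. *)
Record split_merge (A D : nat -> R) (Q : 'I_k -> nat -> R) : Prop :=
  SplitMerge {
  arrival_ge0 : 0 <= A 1%N ;
  arrival_nondecreasing : forall n, (1 <= n)%N -> A n <= A n.+1 ;
  task_service_ge0 : forall i n, (1 <= n)%N -> 0 <= Q i n ;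
  departure0 : D 0%N = 0 ;
  departure_job : forall n, (1 <= n)%N ->
    job_departure (job_start A D n) (Q^~ n) (D n) }.

End SplitMerge.

Section MaxPlus.
Context {R : realType}.

Definition job_service (A D : nat -> R) (n : nat) : R := D n - job_start A D n.

Definition service_process (Delta : nat -> R) (m n : nat) : R :=
  \sum_(m <= nu < n.+1) Delta nu.

(* The seed of the maximum is its term of index 1. *)
Definition max_plus_server (A D : nat -> R) (S : nat -> nat -> R) : Prop :=
  forall n, (1 <= n)%N ->
    D n <= \big[Num.max/(A 1%N + S 1%N n)]_(1 <= m < n.+1) (A m + S m n).

(* Meaningful for theta in ]0, mu[; [rho_Z] is so for theta in ]0, l mu[. *)
Definition rho_X (l : nat) (mu theta : R) : R :=
  theta^-1 * \sum_(1 <= i < l.+1) ln (i%:R * mu / (i%:R * mu - theta)).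

Definition rho_Z (l : nat) (mu theta : R) : R :=
  theta^-1 * ln (l%:R * mu / (l%:R * mu - theta)).

End MaxPlus.

Section Stochastic.
Context {d : measure_display} {T : measurableType d} {R : realType}
  (P : probability T R).

(* ['M_P X theta] is the expectation of [expR (theta * X)]. *)
Definition has_envelope_rate (range : set R) (S : nat -> nat -> T -> R)
    (rho : R -> R) : Prop :=
  forall m n theta, (1 <= m)%N -> (m <= n)%N -> range theta ->
    ('M_P (S m n) theta <=
     (expR (theta * rho theta * (n - m + 1)%N%:R))%:E)%E.

Definition mutually_independent {I : choiceType} (J : set I)
    (X : I -> {RV P >-> R}) : Prop :=
  forall (s : {fset I}) (B : I -> set R),
    [set` s] `<=` J -> (forall i, measurable (B i)) ->
    P (\bigcap_(i in [set` s]) (X i @^-1` B i)) =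
    (\prod_(i <- s) P (X i @^-1` B i))%E.

Definition iid_exponential {I : choiceType} (J : set I)
    (X : I -> {RV P >-> R}) (mu : R) : Prop :=
  mutually_independent J X /\
  forall i, J i -> forall B, measurable B ->
    distribution P (X i) B = exponential_prob mu B.

End Stochastic.

(* Main.v *)
(* The job service time is a symmetric function of the residual service times of
   the running tasks. By memorylessness, at each task completion the time elapsed
   since the previous one is exponential, and the residual times of the other
   running tasks, together with the service time of the task just fetched, are
   fresh independent exponential variables. Hence the job service time is
   distributed as a sum of independent exponential variables: [k - l] of rate
   [l * mu] while the queue is not empty, then one of rate [i * mu] for each
   [i = l, ..., 1]. Its exponential moment is a product, its mean a sum. *)
Require Import Defs.
From HB Require Import structures.
From mathcomp Require Import all_boot all_order all_algebra finmap.
From mathcomp Require Import all_classical all_reals all_analysis.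
From mathcomp Require Import measurable_realfun ring lra zify.
Set Implicit Arguments.
Unset Strict Implicit.
Unset Printing Implicit Defensive.
Import Order.TTheory GRing.Theory Num.Theory.
Import numFieldNormedType.Exports.
Local Open Scope classical_set_scope.
Local Open Scope ring_scope.

(** * Integrals against one or two exponential laws *)

Section ExponentialIntegral.
Local Open Scope ereal_scope.
Context {R : realType}.
Local Notation leb := (@lebesgue_measure R).
Implicit Types (a b x y z u : R) (g h : R -> \bar R).

(** Nothing is conditioned on which running task ends first, as that task is random. Instead, the
    job service time is a deterministic function [job_time] of the list of service times.
    Independence serves only to turn an expectation over the sample space into an iterated integral
    over the entries of this list, and memorylessness is an identity between such integrals.

    These identities are proved for an arbitrary nonnegative measurable function [phi] of the job
    service time. Nonnegativity gives Tonelli's theorem without integrability conditions. Generality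
    lets an induction absorb the time [z] already elapsed, by passing from [phi] to
    [fun x => phi (z + x)]. The exponential moment and the mean are then two choices of [phi].

    Ties between workers are settled by keeping only the list of the instants at which they become
    free, up to permutation. *)

Definition exponential_probability a (a0 : (0 < a)%R) :
    probability (measurableTypeR R) R :=
  @exponential_distribution_exponential_prob__canonical__probability_measure_Probability
    R a a0.

(** The Radon-Nikodym derivative of the law and [exponential_pdf a] have the same integral over
    every measurable set, hence agree almost everywhere. *)
Lemma ge0_integral_exponential_prob a g : (0 < a)%R ->
  measurable_fun [set: R] g -> (forall x, 0 <= g x) ->
  \int[exponential_prob a]_x g x = \int[leb]_x (g x * (exponential_pdf a x)%:E).
Proof.
move=> a0 mg g0.
have mpdf : measurable_fun setT (EFin \o exponential_pdf a).
  by apply/measurable_EFinP; exact: measurable_exponential_pdf.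
pose nu := exponential_probability a0.
have dom : nu `<< leb.
  apply/null_content_dominatesP => A mA A0; rewrite /nu/= /exponential_prob.
  by apply: null_set_integral => //; exact: measurable_funTS.
change (\int[nu]_x g x = \int[leb]_x (g x * (exponential_pdf a x)%:E)).
rewrite -(Radon_Nikodym_SigmaFinite.change_of_variables dom)//.
have mf := measurable_int _ (Radon_Nikodym_SigmaFinite.f_integrable dom).
apply: ae_eq_integral => //.
- exact: emeasurable_funM.
- exact: emeasurable_funM.
- apply: ae_eqe_mul2l; apply: integral_ae_eq => //.
  + exact: Radon_Nikodym_SigmaFinite.f_integrable.
  + by move=> E _ mE; rewrite -Radon_Nikodym_SigmaFinite.f_integral.
Qed.

(** The image of Lebesgue measure under a translation gives intervals their length, so it is
    Lebesgue measure by uniqueness. *)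
Lemma ge0_integral_shift z g :
  measurable_fun [set: R] g -> (forall x, 0 <= g x) ->
  \int[leb]_x g (z + x)%R = \int[leb]_x g x.
Proof.
move=> mg g0.
have mz : measurable_fun setT (fun x : R => (z + x)%R).
  by apply: measurable_funD => //; exact: measurable_cst.
have /= <- := @ge0_integral_pushforward _ _ (measurableTypeR R) (measurableTypeR R)
  R _ mz leb setT g measurableT mg (fun x _ => g0 x).
apply: eq_measure_integral => A mA _.
apply/esym/lebesgue_measure_unique => //.
move=> _ [[u v] _ <-]/=; rewrite /pushforward.
rewrite (_ : _ @^-1` _ = `](u - z)%R, (v - z)%R]%classic); last first.
  by apply/seteqP; split=> x /=; rewrite !in_itv/= ltrBlDl lerBrDl.
rewrite !lebesgue_measure_itv/= !lte_fin ltrD2r -!EFinB.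
rewrite (_ : v - z - (u - z) = v - u)%R//; lra.
Qed.

(* The law of the variable is carried by the nonnegative reals, so that taking
   [g] at [`|x|] changes nothing, but makes the values of [g] at negative reals
   irrelevant everywhere instead of almost everywhere. *)
Definition exp_mean a g : \bar R := \int[exponential_prob a]_x g `|x|%R.

Lemma exp_mean_ge0 a g : (0 < a)%R -> (forall x, 0 <= g x) -> 0 <= exp_mean a g.
Proof.
move=> a0 g0; change (0 <= \int[exponential_probability a0]_x g `|x|%R).
by apply: integral_ge0 => x _; exact: g0.
Qed.

Lemma measurable_fun_norm g : measurable_fun [set: R] g ->
  measurable_fun [set: R] (fun x => g `|x|%R).
Proof.
move=> mg; exact: measurableT_comp mg (@normr_measurable R setT).
Qed.

Lemma exp_meanE a g : (0 < a)%R -> measurable_fun [set: R] g -> (forall x, 0 <= g x) ->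
  exp_mean a g = \int[leb]_x (g `|x|%R * (exponential_pdf a x)%:E).
Proof.
move=> a0 mg g0; rewrite /exp_mean ge0_integral_exponential_prob//.
exact: measurable_fun_norm.
Qed.

Lemma eq_exp_mean a g h : (0 < a)%R -> (forall x, (0 <= x)%R -> g x = h x) ->
  exp_mean a g = exp_mean a h.
Proof.
move=> a0 gh; change (\int[exponential_probability a0]_x g `|x|%R =
  \int[exponential_probability a0]_x h `|x|%R).
by apply: eq_integral => x _; exact: gh.
Qed.

Lemma measurable_exponential_pdfE a :
  measurable_fun [set: R] (EFin \o exponential_pdf a).
Proof. by apply/measurable_EFinP; exact: measurable_exponential_pdf. Qed.

Lemma exponential_pdf_shift b x u : (0 <= x)%R -> (0 <= u)%R ->
  exponential_pdf b (x + u)%R = (expR (- b * x) * exponential_pdf b u)%R.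
Proof.
move=> x0 u0; rewrite !exponential_pdfE ?addr_ge0// mulrDr expRD; ring.
Qed.

Lemma exponential_pdf_mul a b x : (0 < a)%R -> (0 < b)%R ->
  (expR (- b * x) * exponential_pdf a x =
   a / (a + b) * exponential_pdf (a + b) x)%R.
Proof.
move=> a0 b0; have [x0|x0] := ltP x 0%R.
  by rewrite !lt0_exponential_pdf// !mulr0.
rewrite !exponential_pdfE//= (_ : - (a + b) * x = - b * x + - a * x)%R; last by ring.
by rewrite expRD; field; lra.
Qed.

Lemma measurable_fun_if_le (F : R -> R -> \bar R) :
  measurable_fun [set: R * R] (fun p => F p.1 p.2) ->
  measurable_fun [set: R * R] (fun p => if (p.1 <= p.2)%R then F p.1 p.2 else 0).
Proof.
move=> mF; apply: measurable_fun_ifT => //.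
exact: measurable_fun_ler.
Qed.

Lemma measurable_fun_norm2 (F : R -> R -> \bar R) :
  measurable_fun [set: R * R] (fun p => F p.1 p.2) ->
  measurable_fun [set: R * R] (fun p => F `|p.1|%R `|p.2|%R).
Proof.
move=> mF.
have mn : measurable_fun [set: R * R] (fun p : R * R => (`|p.1|, `|p.2|)%R).
  by apply: measurable_fun_pair; exact: measurableT_comp.
exact: measurableT_comp mF mn.
Qed.

Lemma measurable_exp_mean d (T : measurableType d) b (F : T -> R -> \bar R) :
  (0 < b)%R -> (forall t x, 0 <= F t x) ->
  measurable_fun [set: T * R] (fun p => F p.1 p.2) ->
  measurable_fun [set: T] (fun t => exp_mean b (F t)).
Proof.
move=> b0 F0 mF.
have mn : measurable_fun [set: T * R] (fun p : T * R => (p.1, `|p.2|)%R).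
  by apply: measurable_fun_pair => //; exact: measurableT_comp.
have mF' : measurable_fun [set: T * R] (fun p => F p.1 `|p.2|%R).
  exact: measurableT_comp mF mn.
exact: (@measurable_fun_fubini_tonelli_F _ _ T (measurableTypeR R) R
  (exponential_probability b0) _ mF').
Qed.

(** Substitute [y = x + u] on the region [x <= y]. The joint density becomes [a / (a + b)] times the
    density of rate [a + b] at [x] times that of rate [b] at [u]: the minimum, the probability that
    the first variable attains it, and the residual of the other. *)
Lemma exp_mean_split_le a b (f : R -> R -> \bar R) : (0 < a)%R -> (0 < b)%R ->
  measurable_fun [set: R * R] (fun p => f p.1 p.2) -> (forall x y, 0 <= f x y) ->
  \int[leb]_x (\int[leb]_y ((if (x <= y)%R then f `|x|%R `|y|%R else 0) *
      (exponential_pdf b y)%:E) * (exponential_pdf a x)%:E) =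
  exp_mean (a + b) (fun t => (a / (a + b))%:E * exp_mean b (fun u => f t (t + u)%R)).
Proof.
move=> a0 b0 mf f0.
have ab0 : (0 < a + b)%R by lra.
have mfa : measurable_fun [set: R * R] (fun p => f p.1 (p.1 + p.2)%R).
  have mn : measurable_fun [set: R * R] (fun p : R * R => (p.1, p.1 + p.2)%R).
    by apply: measurable_fun_pair => //; exact: measurable_funD.
  exact: measurableT_comp mf mn.
rewrite (exp_meanE ab0); last 2 first.
- apply: emeasurable_funM; first exact: measurable_cst.
  exact: measurable_exp_mean.
- move=> x; apply: mule_ge0; first by rewrite lee_fin divr_ge0//; lra.
  exact: exp_mean_ge0.
apply: eq_integral => x _.
have [x0|x0] := ltP x 0%R; first by rewrite !lt0_exponential_pdf// !mule0.
rewrite -(@ge0_integral_shift x); first last.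
- move=> y; rewrite mule_ge0//; first by case: ifP.
  by rewrite lee_fin exponential_pdf_ge0// ltW.
- apply: emeasurable_funM; last exact: measurable_exponential_pdfE.
  have := @measurable_fun_if_le (fun u v => f `|u|%R `|v|%R) (measurable_fun_norm2 mf).
  exact: measurable_fun_pair2.
rewrite (ger0_norm x0).
transitivity (\int[leb]_u ((expR (- b * x))%:E * (f x (x + `|u|)%R * (exponential_pdf b u)%:E))
  * (exponential_pdf a x)%:E).
  congr (_ * _); apply: eq_integral => u _.
  have [u0|u0] := ltP u 0%R.
    by rewrite (lt0_exponential_pdf _ u0) !mule0 lerDl leNgt u0 mul0e.
  rewrite lerDl u0 !ger0_norm ?addr_ge0// exponential_pdf_shift// EFinM.
  by rewrite muleCA.
rewrite ge0_integralZl_EFin ?expR_ge0//; last 2 first.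
- by move=> u _; rewrite mule_ge0// lee_fin exponential_pdf_ge0// ltW.
- apply: emeasurable_funM; last exact: measurable_exponential_pdfE.
  have := measurable_fun_pair2 x mfa.
  exact: (@measurable_fun_norm (fun u => f x (x + u)%R)).
rewrite -(@exp_meanE b (fun u => f x (x + u)%R))//; last exact: (measurable_fun_pair2 x mfa).
rewrite muleAC -EFinM exponential_pdf_mul// EFinM.
by rewrite muleAC.
Qed.

Lemma integral_if_lt b y (g : R -> \bar R) : (0 < b)%R ->
  measurable_fun [set: R] g -> (forall x, 0 <= g x) ->
  \int[leb]_x ((if (y < x)%R then g x else 0) * (exponential_pdf b x)%:E) =
  \int[leb]_x ((if (y <= x)%R then g x else 0) * (exponential_pdf b x)%:E).
Proof.
move=> b0 mg g0.
have mle : measurable_fun [set: R] (fun x => if (y <= x)%R then g x else 0).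
  apply: measurable_fun_ifT => //.
  by apply: measurable_fun_ler => //; exact: measurable_cst.
have mlt : measurable_fun [set: R] (fun x => if (y < x)%R then g x else 0).
  apply: measurable_fun_ifT => //.
  by apply: measurable_fun_ltr => //; exact: measurable_cst.
apply: ae_eq_integral => //.
- apply: emeasurable_funM => //; exact: measurable_exponential_pdfE.
- apply: emeasurable_funM => //; exact: measurable_exponential_pdfE.
exists [set y]; split => //; first exact: lebesgue_measure_set1.
move=> x /= /not_implyP[_ +]; apply: contra_notP => /eqP xy.
by rewrite lt_neqAle eq_sym xy.
Qed.

Lemma exponential_pdf_ge0E c x : (0 < c)%R -> 0 <= (exponential_pdf c x)%:E.
Proof. by move=> c0; rewrite lee_fin exponential_pdf_ge0// ltW. Qed.

Lemma measurable_fun_mulpdf2 b (F : R -> R -> \bar R) :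
  measurable_fun [set: R * R] (fun p => F p.1 p.2) ->
  measurable_fun [set: R * R] (fun p => F p.1 p.2 * (exponential_pdf b p.2)%:E).
Proof.
move=> mF; apply: emeasurable_funM => //.
exact: measurableT_comp (@measurable_exponential_pdfE b) (@measurable_snd _ _ R R).
Qed.

Lemma measurable_integral_mulpdf b (F : R -> R -> \bar R) : (0 < b)%R ->
  measurable_fun [set: R * R] (fun p => F p.1 p.2) ->
  (forall x y, 0 <= F x y) ->
  measurable_fun [set: R] (fun x => \int[leb]_y (F x y * (exponential_pdf b y)%:E)).
Proof.
move=> b0 mF F0.
have F0' (p : R * R) : 0 <= F p.1 p.2 * (exponential_pdf b p.2)%:E.
  by rewrite mule_ge0// exponential_pdf_ge0E.
exact: (@measurable_fun_fubini_tonelli_F _ _ R (measurableTypeR R) R leb _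
  (measurable_fun_mulpdf2 b mF) F0').
Qed.

(** The integral is split according to which variable is smaller, ties going to the first one. Each
    part is an instance of [exp_mean_split_le], the second one with the two variables exchanged. *)
Lemma exp_mean_min a b (f : R -> R -> \bar R) : (0 < a)%R -> (0 < b)%R ->
  measurable_fun [set: R * R] (fun p => f p.1 p.2) -> (forall x y, 0 <= f x y) ->
  exp_mean a (fun x => exp_mean b (f x)) =
  exp_mean (a + b) (fun t => (a / (a + b))%:E * exp_mean b (fun u => f t (t + u)%R)) +
  exp_mean (b + a) (fun t => (b / (b + a))%:E * exp_mean a (fun u => f (t + u)%R t)).
Proof.
move=> a0 b0 mf f0.
have mfT : measurable_fun [set: R * R] (fun p => f p.2 p.1).
  by have := measurableT_comp mf (@measurable_swap _ _ R R).
rewrite -exp_mean_split_le// -(@exp_mean_split_le _ _ (fun y x => f x y))//.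
have mfn := measurable_fun_norm2 mf.
have mle := @measurable_fun_if_le (fun x y => f `|x|%R `|y|%R) mfn.
have mlt : measurable_fun [set: R * R]
    (fun p => if (p.2 < p.1)%R then f `|p.1|%R `|p.2|%R else 0).
  by apply: measurable_fun_ifT => //; exact: measurable_fun_ltr.
have mpdf := @measurable_exponential_pdfE.
have pdf0 := exponential_pdf_ge0E.
pose fle x y := if (x <= y)%R then f `|x|%R `|y|%R else 0.
pose flt x y := if (y < x)%R then f `|x|%R `|y|%R else 0.
have fle0 x y : 0 <= fle x y by rewrite /fle; case: ifP.
have flt0 x y : 0 <= flt x y by rewrite /flt; case: ifP.
have ige0 (g : R -> R -> \bar R) x : (forall x y, 0 <= g x y) ->
    0 <= \int[leb]_y (g x y * (exponential_pdf b y)%:E).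
  by move=> g0; apply: integral_ge0 => y _; rewrite mule_ge0// pdf0.
have ige0' (g : R -> R -> \bar R) x : (forall x y, 0 <= g x y) ->
    0 <= \int[leb]_y (g x y * (exponential_pdf b y)%:E) * (exponential_pdf a x)%:E.
  by move=> g0; rewrite mule_ge0 ?pdf0 ?ige0.
have mi (g : R -> R -> \bar R) : (forall x y, 0 <= g x y) ->
    measurable_fun [set: R * R] (fun p => g p.1 p.2) ->
    measurable_fun [set: R] (fun x => \int[leb]_y (g x y * (exponential_pdf b y)%:E)
      * (exponential_pdf a x)%:E).
  move=> g0 mg; apply: emeasurable_funM; last exact: mpdf.
  exact: measurable_integral_mulpdf.
transitivity (\int[leb]_x (\int[leb]_y (f `|x|%R `|y|%R * (exponential_pdf b y)%:E) *
    (exponential_pdf a x)%:E)).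
  rewrite (exp_meanE a0); last 2 first.
    exact: measurable_exp_mean.
    by move=> x; exact: exp_mean_ge0.
  apply: eq_integral => x _; rewrite exp_meanE//; exact: (measurable_fun_pair2 _ mf).
transitivity (\int[leb]_x (\int[leb]_y ((if (x <= y)%R then f `|x|%R `|y|%R else 0) *
      (exponential_pdf b y)%:E) * (exponential_pdf a x)%:E) +
  \int[leb]_x (\int[leb]_y ((if (y < x)%R then f `|x|%R `|y|%R else 0) *
      (exponential_pdf b y)%:E) * (exponential_pdf a x)%:E)).
  rewrite -[X in _ = X + _]/(\int[leb]_x (\int[leb]_y (fle x y *
      (exponential_pdf b y)%:E) * (exponential_pdf a x)%:E)).
  rewrite -[X in _ = _ + X]/(\int[leb]_x (\int[leb]_y (flt x y *
      (exponential_pdf b y)%:E) * (exponential_pdf a x)%:E)).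
  rewrite -ge0_integralD//; last 4 first.
  - by move=> x _; exact: ige0'.
  - exact: mi.
  - by move=> x _; exact: ige0'.
  - exact: mi.
  apply: eq_integral => x _; rewrite -ge0_muleDl ?ige0//.
  have mb (g : R -> R -> \bar R) : measurable_fun [set: R * R] (fun p => g p.1 p.2) ->
      measurable_fun [set: R] (fun y => g x y * (exponential_pdf b y)%:E).
    by move=> mg; exact: (measurable_fun_pair2 x (measurable_fun_mulpdf2 b mg)).
  rewrite -ge0_integralD//; last 4 first.
  - by move=> y _; rewrite mule_ge0// pdf0.
  - exact: mb.
  - by move=> y _; rewrite mule_ge0// pdf0.
  - exact: mb.
  congr (_ * _); apply: eq_integral => y _.
  rewrite -ge0_muleDl// /fle /flt.
  by rewrite leNgt; case: ltP; rewrite /= ?adde0 ?add0e.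
apply: f_equal.
have mlt' : measurable_fun [set: R * R]
    (fun p => flt p.1 p.2 * (exponential_pdf b p.2)%:E * (exponential_pdf a p.1)%:E).
  apply: emeasurable_funM; first exact: measurable_fun_mulpdf2.
  exact: measurableT_comp (mpdf a) (@measurable_fst _ _ R R).
(* Both densities are brought under the inner integral, so that Tonelli can make the smaller
   variable [y] the outer one. *)
transitivity (\int[leb]_x (\int[leb]_y (flt x y *
      (exponential_pdf b y)%:E * (exponential_pdf a x)%:E))).
  apply: eq_integral => x _; rewrite ge0_integralZr ?pdf0//.
  - exact: (measurable_fun_pair2 x (measurable_fun_mulpdf2 b mlt)).
  - by move=> y _; rewrite mule_ge0// pdf0.
rewrite (@fubini_tonelli _ _ (measurableTypeR R) (measurableTypeR R) R leb leb _ mlt'); last first.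
  by move=> p; rewrite !mule_ge0// pdf0.
apply: eq_integral => y _ /=.
(* The exchanged instance has [y <= x] where [flt] has [y < x]; the two regions differ by a null set
   for each [y]. *)
rewrite -(@integral_if_lt a y (fun x => f `|x|%R `|y|%R))//; last first.
  exact: (measurable_fun_pair1 y mfn).
rewrite -ge0_integralZr; last 4 first.
- exact: measurableT.
- exact: emeasurable_funM (measurable_fun_pair1 y mlt) (mpdf a).
- by move=> x _; rewrite mule_ge0 ?pdf0//; case: ifP.
- exact: pdf0.
by apply: eq_integral => x _; rewrite muleAC.
Qed.

Lemma exp_meanD a g h : (0 < a)%R ->
  measurable_fun [set: R] g -> (forall x, 0 <= g x) ->
  measurable_fun [set: R] h -> (forall x, 0 <= h x) ->
  exp_mean a (fun x => g x + h x) = exp_mean a g + exp_mean a h.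
Proof.
move=> a0 mg g0 mh h0.
by apply: (@ge0_integralD _ _ _ (exponential_probability a0)) => //; exact: measurable_fun_norm.
Qed.

Lemma exp_meanZl a g (c : R) : (0 < a)%R -> (0 <= c)%R ->
  measurable_fun [set: R] g -> (forall x, 0 <= g x) ->
  exp_mean a (fun x => c%:E * g x) = c%:E * exp_mean a g.
Proof.
move=> a0 c0 mg g0.
by apply: (@ge0_integralZl_EFin _ _ _ (exponential_probability a0)) => //; exact: measurable_fun_norm.
Qed.

Lemma exp_mean_cst a (c : R) : (0 < a)%R -> exp_mean a (fun=> c%:E) = c%:E.
Proof.
move=> a0; change (\int[exponential_probability a0]_x (cst c%:E) x = c%:E).
rewrite integral_cst//; change (c%:E * exponential_probability a0 setT = c%:E).
by rewrite probability_setT mule1.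
Qed.

Lemma integral_exp_mean_swap d (T : measurableType d) (m : probability T R) a
    (F : T -> R -> \bar R) : (0 < a)%R ->
  measurable_fun [set: T * R] (fun p => F p.1 p.2) -> (forall t x, 0 <= F t x) ->
  \int[m]_t exp_mean a (F t) = exp_mean a (fun x => \int[m]_t F t x).
Proof.
move=> a0 mF F0.
have mn : measurable_fun [set: T * R] (fun p : T * R => (p.1, `|p.2|)%R).
  by apply: measurable_fun_pair => //; exact: measurableT_comp.
have mF' : measurable_fun [set: T * R] (fun p => F p.1 `|p.2|%R).
  exact: measurableT_comp mF mn.
exact: (@fubini_tonelli _ _ T (measurableTypeR R) R m (exponential_probability a0) _ mF').
Qed.

End ExponentialIntegral.

(** * List scheduling on anonymous workers *)

Section ListScheduling.
Context {R : realType}.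
Implicit Types (x y z t m q : R) (s r qs : seq R).

Definition translate z s := [seq z + x | x <- s].

(** One bubble pass. Its results are built from minima and maxima only, so that their measurability
    is immediate. *)
Fixpoint popmin x s : R * seq R :=
  if s is y :: s' then
    let p := popmin (Num.min x y) s' in (p.1, Num.max x y :: p.2)
  else (x, [::]).

Lemma perm_popmin x s : perm_eq ((popmin x s).1 :: (popmin x s).2) (x :: s).
Proof.
elim: s x => [//|y s IHs] x /=.
rewrite (perm_catCA [:: _] [:: _])/=.
have := IHs (Num.min x y); rewrite -(perm_cons (Num.max x y)).
move=> /perm_trans; apply.
have [xy|yx] := leP x y; last by [].
by rewrite (perm_catCA [:: _] [:: _]).
Qed.

Lemma popmin_le x s : all (fun y => (popmin x s).1 <= y) (x :: s).
Proof.
elim: s x => [x|y s IHs x] /=; first by rewrite lexx.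
have /= /andP[] := IHs (Num.min x y).
by rewrite le_min => /andP[-> ->].
Qed.

Lemma popmin_eq x s m r : perm_eq (x :: s) (m :: r) -> all (fun y => m <= y) r ->
  (popmin x s).1 = m /\ perm_eq (popmin x s).2 r.
Proof.
move=> sr mr; have sp := perm_trans (perm_popmin x s) sr.
have pm : (popmin x s).1 = m.
  apply/le_anti/andP; split.
    by apply: (allP (popmin_le x s)); rewrite (perm_mem sr) mem_head.
  have : (popmin x s).1 \in m :: r by rewrite -(perm_mem sp) mem_head.
  by rewrite inE => /predU1P[->//|]; exact: (allP mr).
by split=> //; rewrite -(perm_cons m) -{1}pm.
Qed.

Lemma popmin_translate z x s : popmin (z + x) (translate z s) =
  (z + (popmin x s).1, translate z (popmin x s).2).
Proof.
by elim: s x => [//|y s IHs] x /=; rewrite -addr_minr IHs -addr_maxr.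
Qed.

(* The workers, free from the instants [s] on, are anonymous: which of them is
   given a task in case of a tie is immaterial by [makespan_perm]. *)
Fixpoint makespan t s qs : R :=
  if qs is q :: qs' then
    if s is x :: s' then makespan t ((popmin x s').1 + q :: (popmin x s').2) qs'
    else t
  else \big[Num.max/t]_(x <- s) x.

Lemma makespan_perm t s r qs : perm_eq s r -> makespan t s qs = makespan t r qs.
Proof.
elim: qs s r => [s r sr|q qs IHqs [|x s] [|y r] sr] /=; first exact: perm_big.
- by [].
- by move/perm_size: sr.
- by move/perm_size: sr.
have mr : all (fun z => (popmin y r).1 <= z) (popmin y r).2.
  by have := popmin_le y r; rewrite -(perm_all _ (perm_popmin y r)) => /andP[].
have sp : perm_eq (x :: s) ((popmin y r).1 :: (popmin y r).2).
  by rewrite (perm_trans sr)// perm_sym perm_popmin.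
have [-> sr'] := popmin_eq sp mr.
by apply: IHqs; rewrite perm_cons.
Qed.

Lemma makespan_min t s m r q qs : perm_eq s (m :: r) -> all (fun y => m <= y) r ->
  makespan t s (q :: qs) = makespan t (m + q :: r) qs.
Proof.
case: s => [/perm_size//|x s] sr mr /=.
have [-> sr'] := popmin_eq sr mr.
by apply: makespan_perm; rewrite perm_cons.
Qed.

Lemma makespan_translate z t s qs :
  makespan (z + t) (translate z s) qs = z + makespan t s qs.
Proof.
elim: qs s => [s|q qs IHqs [|x s]] //=; last first.
  by rewrite popmin_translate /= -addrA -IHqs.
elim: s => [|x s IHs]; first by rewrite !big_nil.
by rewrite /= !big_cons IHs addr_maxr.
Qed.

(** The seed enters only the final maximum, where it is dominated: nonnegative service times keep
    all the entries above it. *)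
Lemma makespan_seed t t' s qs : s != [::] -> all (fun x => 0 <= x) qs ->
  all (fun x => t <= x) s -> all (fun x => t' <= x) s ->
  makespan t s qs = makespan t' s qs.
Proof.
elim: qs s => [|q qs IHqs] [|x s]//= _.
  elim: s x => [|y s IHs] x _ /andP[tx ts] /andP[t'x t's].
    by rewrite !big_cons !big_nil !max_l.
  by rewrite big_cons [RHS]big_cons IHs.
move=> /andP[q0 qs0] ts ts'; apply: IHqs => //=.
  have : all (fun x => t <= x) (x :: s) by [].
  rewrite -(perm_all _ (perm_popmin x s)) => /= /andP[tx ->].
  by rewrite (le_trans tx)// lerDl.
have : all (fun x => t' <= x) (x :: s) by [].
rewrite -(perm_all _ (perm_popmin x s)) => /= /andP[tx ->].
by rewrite (le_trans tx)// lerDl.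
Qed.

Lemma makespan_ge t s qs : t <= makespan t s qs.
Proof.
elim: qs s => [s|q qs IHqs [|x s]] //=; exact: bigmax_ge_id.
Qed.

(** With the job started at 0, the first [l] service times are themselves the instants at which the
    workers first become free. *)
Definition job_time l qs := makespan 0 (take l qs) (drop l qs).

End ListScheduling.

(** * From a schedule with named workers to [job_time] *)

Section Schedule.
Context {R : realType} (l k : nat) (t0 : R) (q : 'I_k -> R).
Variables (worker : 'I_k -> 'I_l) (start : 'I_k -> R).
Hypotheses (hlk : (l <= k)%N) (q0 : forall i, 0 <= q i).
Hypothesis sched : fifo_schedule t0 q worker start.

(** This is [free_time] with a natural number as its last argument, so that the state after the last
    task, of index [k], makes sense. *)
Let free v (i : nat) : R :=
  \big[Num.max/t0]_(j < k | (j < i)%N && (worker j == v)) (start j + q j).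

Let state i := [seq free v i | v <- enum 'I_l].

Lemma free_step v (i : 'I_k) : free v i.+1 =
  if worker i == v then Num.max (free v i) (start i + q i) else free v i.
Proof.
case: ifPn => iv.
  rewrite /free (bigmaxD1 i) ?ltnSn ?iv// maxC; congr Num.max.
  apply: eq_bigl => j; rewrite ltnS leq_eqVlt andbAC -[X in _ && X]negbK negbK.
  have [->|ji] := eqVneq j i; first by rewrite andbF ltnn.
  by rewrite andbT (inj_eq val_inj) (negbTE ji).
apply: eq_bigl => j; rewrite ltnS leq_eqVlt (inj_eq val_inj).
by case: eqVneq => //= ->; rewrite (negbTE iv) andbF.
Qed.

(** The worker fetching task [i] attains the minimum of the state, and its entry alone changes, by
    [q i]: this is one step of [makespan]. *)
Lemma state_step (i : 'I_k) qs : (l <= i)%N ->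
  makespan t0 (state i) (q i :: qs) = makespan t0 (state i.+1) qs.
Proof.
move=> li; pose w := worker i.
have pw : perm_eq (enum 'I_l) (w :: rem w (enum 'I_l)).
  by rewrite perm_to_rem// mem_enum.
have uw : w \notin rem w (enum 'I_l) by rewrite mem_rem_uniqF// enum_uniq.
have si : start i = free w i by exact: (next_task_start sched).
rewrite (makespan_min _ _ _ (perm_map (free ^~ i) pw)); last first.
  apply/allP => _ /mapP[v _ ->]; rewrite -si.
  exact: (next_task_earliest sched).
apply: makespan_perm; rewrite perm_sym.
rewrite (perm_trans (perm_map (free ^~ i.+1) pw))//=.
rewrite free_step eqxx -si max_r ?lerDl//.
rewrite (_ : map _ _ = [seq free v i | v <- rem w (enum 'I_l)])//.
apply/eq_in_map => v vw; rewrite free_step ifN//.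
by apply/eqP => wv; case/negP: uw; rewrite [w]wv -wv; move: vw; rewrite -wv.
Qed.

(** Backward induction from the end of the queue: [n] counts the tasks still to be fetched. *)
Lemma state_last n : (n <= k - l)%N ->
  makespan t0 (state (k - n)) [seq q j | j <- drop (k - n) (enum 'I_k)] =
  makespan t0 (state k) [::].
Proof.
elim: n => [|n IHn] nkl; first by rewrite subn0 drop_oversize// size_enum_ord.
have kn : (k - n.+1 < k)%N by lia.
have Skn : (k - n.+1).+1 = (k - n)%N by lia.
rewrite -(IHn (ltnW nkl)) (drop_nth (Ordinal kn)) ?size_enum_ord//.
rewrite (_ : nth _ _ _ = Ordinal kn); last by apply: val_inj; rewrite /= nth_enum_ord.
rewrite map_cons -Skn (@state_step (Ordinal kn))//=; lia.
Qed.

(** The first [l] tasks go to distinct workers, and there are [l] workers, so by counting each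
    worker has exactly one of them. *)
Lemma state_first : perm_eq (state l) [seq t0 + q j | j <- take l (enum 'I_k)].
Proof.
have tl (j : 'I_k) : j \in take l (enum 'I_k) -> (j < l)%N.
  move=> /(map_f val); rewrite map_take val_enum_ord take_iota mem_iota.
  by rewrite (minn_idPl hlk).
have uw : uniq [seq worker j | j <- take l (enum 'I_k)].
  rewrite map_inj_in_uniq ?take_uniq ?enum_uniq// => i j /tl il /tl jl.
  exact: (first_tasks_workers sched).
have pw : perm_eq (enum 'I_l) [seq worker j | j <- take l (enum 'I_k)].
  rewrite perm_sym uniq_perm ?enum_uniq//.
  have [||_ //] := uniq_min_size uw (s2 := enum 'I_l).
    by move=> v _; rewrite mem_enum.
  by rewrite size_enum_ord size_map size_takel ?size_enum_ord.
rewrite (perm_trans (perm_map (free ^~ l) pw))//.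
rewrite -map_comp (_ : map _ _ = [seq t0 + q j | j <- take l (enum 'I_k)])//.
apply/eq_in_map => j /tl jl /=.
rewrite /free (bigmaxD1 j) ?jl ?eqxx//.
rewrite big_pred0 ?(first_tasks_start sched)// ?max_l ?lerDl// => i.
apply/negbTE/negP => /andP[/andP[il /eqP/(first_tasks_workers sched il jl) ->]].
by rewrite eqxx.
Qed.

Lemma makespan_state_last : makespan t0 (state k) [::] = \big[Num.max/t0]_i (start i + q i).
Proof.
rewrite /= big_map; apply/le_anti/andP; split.
  rewrite big_enum; apply: bigmax_le; first exact: bigmax_ge_id.
  move=> v _; apply: bigmax_le => [|i _]; first exact: bigmax_ge_id.
  exact: le_bigmax.
apply: bigmax_le => [|i _]; first exact: bigmax_ge_id.
rewrite big_enum; apply: (bigmax_sup (worker i)) => //.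
by apply: (bigmax_sup i) => //; rewrite ltn_ord eqxx.
Qed.

Lemma schedule_makespan : \big[Num.max/t0]_i (start i + q i) =
  t0 + job_time l [seq q i | i <- enum 'I_k].
Proof.
rewrite -makespan_state_last -(state_last (leqnn _)) subKn//.
rewrite (makespan_perm _ _ state_first) /job_time -makespan_translate addr0.
by rewrite -map_take -map_drop /translate -map_comp.
Qed.

End Schedule.

Lemma job_departureE (R : realType) (l k : nat) (t0 d : R) (q : 'I_k -> R) :
  (l <= k)%N -> (forall i, 0 <= q i) -> job_departure l t0 q d ->
  d = t0 + job_time l [seq q i | i <- enum 'I_k].
Proof. move=> lk q0 [worker [start [sched ->]]]; exact: (schedule_makespan lk q0 sched). Qed.

(** The witness [m] is the job that opened the current busy period. A job that starts on arrival is
    its own witness; one that waits keeps the witness of its predecessor. Job 1 always starts on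
    arrival, since [D 0 = 0 <= A 1]. *)
Lemma split_merge_max_plus (R : realType) (l k : nat) (A D : nat -> R)
    (Q : 'I_k -> nat -> R) : split_merge l A D Q ->
  max_plus_server A D (service_process (job_service A D)).
Proof.
move=> sys n n1; pose S := service_process (job_service A D).
have [m mn Dn] : exists2 m, (1 <= m <= n)%N & D n <= A m + S m n.
  have DE p : D p = job_start A D p + job_service A D p.
    by rewrite /job_service addrC subrK.
  case: n n1 => // n _; elim: n => [|n [m /andP[m1 mn] IHn]].
    exists 1%N => //; rewrite DE /S /service_process big_nat1 /job_start /=.
    by rewrite (departure0 sys) max_l ?(arrival_ge0 sys).
  have [AD|DA] := leP (A n.+2) (D n.+1).
    exists m; first by rewrite m1 leqW.
    have -> : S m n.+2 = S m n.+1 + job_service A D n.+2.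
      rewrite /S /service_process big_nat_recr//; exact: leqW.
    by rewrite DE /job_start max_r//= (addrA (A m)) lerD2r.
  exists n.+2; first by rewrite leqnn.
  by rewrite DE /S /service_process big_nat1 /job_start max_l// ltW.
apply: (le_trans Dn).
apply: (le_bigmax_seq _ m xpredT (fun m => A m + S m n)) => //.
by rewrite mem_index_iota ltnS.
Qed.

(** * Iterated exponential integrals and memorylessness *)

Section IteratedIntegral.
Local Open Scope ereal_scope.
Context {R : realType}.

Inductive measurable_seq d (T : measurableType d) : nat -> (T -> seq R) -> Prop :=
| measurable_nil : measurable_seq 0 (fun=> [::])
| measurable_seq_cons n f F : measurable_fun [set: T] f -> measurable_seq n F ->
    measurable_seq n.+1 (fun t => f t :: F t).

(* Joint measurability in [t] and in the [n] entries of the list, tested against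
   all measurable sources, so that no measurable structure on lists is needed. *)
Definition measurable_functional d (T : measurableType d) n (G : T -> seq R -> \bar R) :=
  forall d' (T' : measurableType d') (y : T' -> T) (F : T' -> seq R),
    measurable_fun [set: T'] y -> measurable_seq n F ->
    measurable_fun [set: T'] (fun t => G (y t) (F t)).

(** The expectation of [G] at [n] independent exponential variables of rate [a], with no measure on
    lists. *)
Fixpoint exp_means (a : R) n (G : seq R -> \bar R) : \bar R :=
  if n is n'.+1 then exp_mean a (fun x => exp_means a n' (fun s => G (x :: s))) else G [::].

Variables (a : R) (a0 : (0 < a)%R).

Lemma exp_means_ge0 n G : (forall s, 0 <= G s) -> 0 <= exp_means a n G.
Proof.
by elim: n G => [|n IHn] G G0 //=; apply: exp_mean_ge0 => // x; exact: IHn.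
Qed.

Lemma eq_exp_means n G H :
  (forall s, size s = n -> all (fun x => 0 <= x)%R s -> G s = H s) ->
  exp_means a n G = exp_means a n H.
Proof.
elim: n G H => [|n IHn] G H GH /=; first exact: GH.
apply: eq_exp_mean => // x x0; apply: IHn => s sn s0.
by apply: GH; rewrite /= ?sn// x0.
Qed.

(** Moving the head of the list into the parameter is what carries measurability through inductions
    on [n]. *)
Lemma measurable_functional_cons d (T : measurableType d) n (G : T -> seq R -> \bar R) :
  measurable_functional n.+1 G ->
  measurable_functional n (fun (p : T * R) s => G p.1 (p.2 :: s)).
Proof.
move=> mG d' T' y F my mF; apply: (mG _ _ (fst \o y) (fun t => (y t).2 :: F t)).
  exact: measurableT_comp.
by constructor => //; exact: measurableT_comp my.
Qed.

Lemma measurable_exp_means d (T : measurableType d) n (G : T -> seq R -> \bar R) :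
  (forall t s, 0 <= G t s) -> measurable_functional n G ->
  measurable_fun [set: T] (fun t => exp_means a n (G t)).
Proof.
elim: n d T G => [|n IHn] d T G G0 mG /=.
  apply: (mG _ _ id (fun=> [::])) => //; exact: measurable_nil.
apply: measurable_exp_mean => //; first by move=> t x; exact: exp_means_ge0.
by apply: (IHn _ _ (fun (p : T * R) s => G p.1 (p.2 :: s))) => //; exact: measurable_functional_cons.
Qed.

Lemma integral_exp_means_swap d (T : measurableType d) (m : probability T R) n
    (G : T -> seq R -> \bar R) :
  (forall t s, 0 <= G t s) -> measurable_functional n G ->
  \int[m]_t exp_means a n (G t) = exp_means a n (fun s => \int[m]_t G t s).
Proof.
elim: n G => [//|n IHn] G G0 mG /=.
rewrite integral_exp_mean_swap//; first last.
- by move=> t x; exact: exp_means_ge0.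
- apply: (measurable_exp_means (G := fun (p : T * R) s => G p.1 (p.2 :: s))) => //.
  exact: measurable_functional_cons.
apply: eq_exp_mean => // x _; apply: IHn => // d' T' y F my mF.
apply: (mG _ _ y (fun t => x :: F t)) => //.
by constructor => //; exact: measurable_cst.
Qed.

Lemma exp_mean_exp_means_swap b n (G : R -> seq R -> \bar R) : (0 < b)%R ->
  (forall t s, 0 <= G t s) -> measurable_functional n G ->
  exp_mean b (fun x => exp_means a n (G x)) = exp_means a n (fun s => exp_mean b (fun x => G x s)).
Proof.
move=> b0 G0 mG; apply: (@integral_exp_means_swap _ _ (exponential_probability b0) n
  (fun x => G `|x|%R)) => //.
by move=> d' T' y F my mF; apply: mG => //; exact: measurableT_comp.
Qed.

Lemma exp_means_cat n m G :
  exp_means a (n + m) G = exp_means a n (fun s => exp_means a m (fun s' => G (s ++ s'))).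
Proof.
elim: n G => [//|n IHn] G /=; apply: eq_exp_mean => // x _; exact: IHn.
Qed.

Lemma exp_meansZl n G (c : R) : (0 <= c)%R -> (forall s, 0 <= G s) ->
  measurable_functional n (fun _ : unit => G) ->
  exp_means a n (fun s => c%:E * G s) = c%:E * exp_means a n G.
Proof.
elim: n G => [//|n IHn] G c0 G0 mG /=.
rewrite -exp_meanZl//; last 2 first.
- apply: (measurable_exp_means (G := fun x s => G (x :: s))) => //.
  move=> d' T' y F my mF; apply: (mG _ _ (cst tt) (fun t => y t :: F t)); last by constructor.
  exact: measurable_cst.
- by move=> x; exact: exp_means_ge0.
apply: eq_exp_mean => // x _; apply: IHn => // d' T' y F my mF.
apply: (mG _ _ y (fun t => x :: F t)) => //.
by constructor => //; exact: measurable_cst.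
Qed.

Lemma measurable_seq_comp d d' (T : measurableType d) (T' : measurableType d') n
    (h : T' -> T) F : measurable_fun [set: T'] h -> measurable_seq n F ->
  measurable_seq n (F \o h).
Proof.
move=> mh; elim => [|{}n f {}F mf mF IH]; first exact: measurable_nil.
by apply: (measurable_seq_cons (f := f \o h)) IH; exact: measurableT_comp.
Qed.

Lemma measurable_seq_translate d (T : measurableType d) n (z : T -> R) F :
  measurable_fun [set: T] z -> measurable_seq n F ->
  measurable_seq n (fun t => translate (z t) (F t)).
Proof.
move=> mz; elim => [|{}n f {}F mf mF IH]; first exact: measurable_nil.
constructor => //; exact: measurable_funD.
Qed.

(* Seen from the smallest of them, the [n] other variables are again independent
   exponential variables; [G] being symmetric, it does not matter which one is
   the smallest. In the induction, the first variable competes with the smallest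
   of the [n.+1] other ones, of rate [n.+1%:R * a]. *)
Lemma exp_means_memoryless n (G : seq R -> \bar R) :
  (forall s, 0 <= G s) -> (forall s s', perm_eq s s' -> G s = G s') ->
  measurable_functional n.+1 (fun _ : unit => G) ->
  exp_means a n.+1 G = exp_mean (n.+1%:R * a)
    (fun z => exp_means a n (fun s => G (z :: translate z s))).
Proof.
elim: n G => [|n IHn] G G0 Gp mG; first by rewrite mul1r.
have mGF d (T : measurableType d) (F : T -> seq R) : measurable_seq n.+2 F ->
    measurable_fun [set: T] (fun t => G (F t)).
  move=> mF; exact: (mG _ _ (cst tt) F (measurable_cst _) mF).
have b0 : (0 < n.+1%:R * a)%R by rewrite mulr_gt0// ltr0n.
set b := (n.+1%:R * a)%R in b0.
pose K x z := exp_means a n (fun s => G (x :: z :: translate z s)).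
have mK : measurable_fun [set: R * R] (fun p => K p.1 p.2).
  apply: (measurable_exp_means (G := fun p s => G (p.1 :: p.2 :: translate p.2 s))) => //.
  move=> d T y F my mF; apply: (mGF _ _ (fun t => (y t).1 :: (y t).2 :: translate (y t).2 (F t))).
  constructor; first exact: measurableT_comp my.
  constructor; first exact: measurableT_comp my.
  by apply: measurable_seq_translate => //; exact: measurableT_comp my.
have K0 x z : 0 <= K x z by exact: exp_means_ge0.
transitivity (exp_mean a (fun x => exp_mean b (K x))).
  change (exp_mean a (fun x => exp_means a n.+1 (fun s => G (x :: s))) =
    exp_mean a (fun x => exp_mean b (K x))).
  apply: eq_exp_mean; first by [].
  move=> x x0; rewrite (IHn (fun s => G (x :: s))).
  - by [].
  - by move=> s; exact: G0.
    by move=> s s' ss'; apply: Gp; rewrite perm_cons.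
  move=> d T y F my mF; apply: (mGF _ _ (fun t => x :: F t)).
  by constructor => //; exact: measurable_cst.
rewrite exp_mean_min//.
(* [L t] is the value when the minimum is [t] and all the other variables start afresh. Both cases
   lead to it, with weights [a / (a + b)] and [b / (a + b)] of sum 1. *)
pose L t := exp_means a n.+1 (fun s => G (t :: translate t s)).
have mL : measurable_fun [set: R] L.
  apply: (measurable_exp_means (G := fun t s => G (t :: translate t s))) => //.
  move=> d T y F my mF; apply: (mGF _ _ (fun t => y t :: translate (y t) (F t))).
  by constructor => //; exact: measurable_seq_translate.
have L0 t : 0 <= L t by exact: exp_means_ge0.
have ab0 : (0 < a + b)%R by rewrite addr_gt0.
have -> : (n.+2%:R * a = a + b)%R by rewrite /b -[in LHS]natr1 mulrDl mul1r addrC.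
rewrite (addrC b a).
transitivity (exp_mean (a + b) (fun t => (a / (a + b))%:E * L t) +
              exp_mean (a + b) (fun t => (b / (a + b))%:E * L t)).
  (* The first variable is the smallest. The induction hypothesis, read backwards, turns the
     residual minimum [u] and the list behind it into [n.+1] fresh variables. *)
  have E1 t : exp_mean b (fun u => K t (t + u)%R) = L t.
    rewrite /L (IHn (fun s => G (t :: translate t s))).
    - apply: eq_exp_mean; first exact: b0.
      move=> u u0; apply: eq_exp_means => s _ _ /=; congr (G [:: _, _ & _]).
      by rewrite /translate -map_comp; apply: eq_map => x /=; rewrite addrA.
    - by move=> s; exact: G0.
    - by move=> s s' ss'; apply: Gp; rewrite perm_cons; exact: perm_map.
    - move=> d T y F my mF; apply: (mGF _ _ (fun t' => t :: translate t (F t'))).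
      constructor; first exact: measurable_cst.
      by apply: (@measurable_seq_translate _ _ _ (cst t)) => //; exact: measurable_cst.
  (* The minimum of the others is the smallest. The residual of the first variable joins the fresh
     list, and symmetry of [G] puts [t] in front. *)
  have E2 t : exp_mean a (fun u => K (t + u)%R t) = L t.
    change (exp_mean a (fun u => K (t + u)%R t) =
      exp_mean a (fun u => exp_means a n (fun s => G (t :: translate t (u :: s))))).
    apply: eq_exp_mean; first exact: a0.
    move=> u u0; apply: eq_exp_means => s _ _; apply: Gp.
    by rewrite -cat1s -[X in perm_eq _ X]cat1s; rewrite (perm_catCA [:: _] [:: _]).
  apply: f_equal2; (apply: eq_exp_mean; first exact: ab0) => t _.
    by rewrite (E1 t).
  by rewrite (E2 t).
have c0 c : (0 < c -> 0 <= c / (a + b))%R by move=> c0; rewrite divr_ge0// ltW.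
rewrite -exp_meanD//; last 4 first.
- by apply: emeasurable_funM => //; exact: measurable_cst.
- by move=> x; rewrite mule_ge0// lee_fin c0.
- by apply: emeasurable_funM => //; exact: measurable_cst.
- by move=> x; rewrite mule_ge0// lee_fin c0.
apply: eq_exp_mean => // t t0.
rewrite -ge0_muleDl ?lee_fin ?c0// -EFinD -mulrDl divff ?gt_eqF// mul1e.
by [].
Qed.

End IteratedIntegral.

(** * The law of the makespan as a sum of exponential variables *)

Section MakespanLaw.
Local Open Scope ereal_scope.
Context {R : realType}.

Lemma measurable_popmin d (T : measurableType d) n (f : T -> R) F :
  measurable_fun [set: T] f -> measurable_seq n F ->
  measurable_fun [set: T] (fun t => (popmin (f t) (F t)).1) /\
  measurable_seq n (fun t => (popmin (f t) (F t)).2).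
Proof.
move=> mf mF; elim: mF f mf => [|{}n g {}F mg mF IH] f mf /=.
  by split => //; exact: measurable_nil.
have [mp1 mp2] := IH (fun t => Num.min (f t) (g t)) (measurable_minr mf mg).
split => //; constructor => //; exact: measurable_maxr.
Qed.

Lemma measurable_bigmax d (T : measurableType d) n (t0 : T -> R) F :
  measurable_fun [set: T] t0 -> measurable_seq n F ->
  measurable_fun [set: T] (fun t => \big[Num.max/t0 t]_(x <- F t) x)%R.
Proof.
move=> mt mF; elim: mF => [|{}n g {}F mg mF IH].
  by under eq_fun do rewrite big_nil.
by under eq_fun do rewrite big_cons; exact: measurable_maxr.
Qed.

Lemma measurable_makespan d (T : measurableType d) l n (t0 : T -> R) S Q :
  measurable_fun [set: T] t0 -> measurable_seq l S -> measurable_seq n Q ->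
  measurable_fun [set: T] (fun t => makespan (t0 t) (S t) (Q t)).
Proof.
move=> mt mS mQ; elim: mQ l S mS => [|{}n q {}Q mq mQ IH] l S mS /=.
  exact: measurable_bigmax mS.
case: mS => [//|{}l f {}S mf mS].
have [mp1 mp2] := measurable_popmin mf mS.
apply: (IH l.+1 (fun t => (popmin (f t) (S t)).1 + q t :: (popmin (f t) (S t)).2)%R).
by constructor => //; exact: measurable_funD.
Qed.

Variables (mu : R) (mu0 : (0 < mu)%R).

(** The expectation of [phi] at a sum of independent exponential variables of rates [rs], a
    hypoexponential variable. *)
Fixpoint hypoexp (rs : seq R) (phi : R -> \bar R) : \bar R :=
  if rs is r :: rs' then exp_mean r (fun z => hypoexp rs' (fun x => phi (z + x)%R))
  else phi 0%R.

Lemma eq_hypoexp rs phi psi : all (fun r => 0 < r)%R rs ->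
  (forall x, (0 <= x)%R -> phi x = psi x) -> hypoexp rs phi = hypoexp rs psi.
Proof.
elim: rs phi psi => [|r rs IH] phi psi /=; first by move=> _; apply.
move=> /andP[r0 rs0] pp; apply: eq_exp_mean => // z z0.
by apply: IH => // x x0; apply: pp; rewrite addr_ge0.
Qed.

Lemma bigmax_translate (z : R) s : (0 <= z)%R -> all (fun x => 0 <= x)%R s ->
  (\big[Num.max/0]_(x <- z :: translate z s) x = z + \big[Num.max/0]_(x <- s) x)%R.
Proof.
move=> z0; rewrite big_cons; elim: s => [|x s IHs] /=.
  by rewrite !big_nil addr0 max_l.
move=> /andP[x0 /IHs]; rewrite !big_cons addr_maxr => <-.
by rewrite maxCA.
Qed.

(** The worker free at [z] is the earliest, so it fetches [q]. All entries then exceed [z], which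
    may replace the seed 0, and the whole computation is a translate by [z]. *)
Lemma makespan_cons_translate (z : R) s q qs : (0 <= z)%R ->
  all (fun x => 0 <= x)%R s -> (0 <= q)%R -> all (fun x => 0 <= x)%R qs ->
  (makespan 0 (z :: translate z s) (q :: qs) = z + makespan 0 (q :: s) qs)%R.
Proof.
move=> z0 s0 q0 qs0.
have zs : all (fun y => z <= y)%R (translate z s).
  by rewrite all_map; apply: sub_all s0 => x /=; rewrite lerDl.
rewrite (makespan_min _ _ _ (perm_refl _) zs) -makespan_translate addr0.
have zqs : all (fun y => z <= y)%R (z + q :: translate z s)%R by rewrite /= lerDl q0.
apply: makespan_seed => //=; apply: sub_all zqs => x; exact: le_trans.
Qed.

(** With an empty queue, each completion leaves one running task fewer, so the rates decrease from
    [n * mu] to [mu]. *)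
Lemma exp_means_bigmax n phi : measurable_fun [set: R] phi -> (forall x, 0 <= phi x) ->
  exp_means mu n (fun s => phi (\big[Num.max/0]_(x <- s) x)%R) =
  hypoexp [seq i%:R * mu | i <- rev (iota 1 n)]%R phi.
Proof.
elim: n phi => [|n IHn] phi mphi phi0; first by rewrite /= big_nil.
rewrite (exp_means_memoryless mu0)//; last 2 first.
- by move=> s s' ss'; rewrite (perm_big _ ss').
- move=> d T y F my mF; apply: measurableT_comp mphi _.
  by apply: measurable_bigmax mF; exact: measurable_cst.
rewrite -(addn1 n) iotaD rev_cat map_cat /= add1n addn1.
apply: eq_exp_mean => [|z z0]; first by rewrite mulr_gt0.
rewrite -IHn//; last first.
  apply: measurableT_comp mphi _; apply: measurable_funD => //.
apply: (eq_exp_means mu0) => s _ s0; congr phi.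
exact: bigmax_translate.
Qed.

(** Induction on the queue length [n]: while a task is fetched at each completion, the number of
    running tasks, hence the rate [l * mu], is constant. *)
Lemma exp_means_makespan l n phi : (0 < l)%N -> measurable_fun [set: R] phi ->
  (forall x, 0 <= phi x) ->
  exp_means mu l (fun s => exp_means mu n (fun qs => phi (makespan 0 s qs))) =
  hypoexp (nseq n (l%:R * mu) ++ [seq i%:R * mu | i <- rev (iota 1 l)])%R phi.
Proof.
case: l => // l _; elim: n phi => [|n IHn] phi mphi phi0; first exact: exp_means_bigmax.
have mphim d (T : measurableType d) l' n' (F F' : T -> seq R) : measurable_seq l' F ->
    measurable_seq n' F' ->
    measurable_fun [set: T] (fun t => phi (makespan 0 (F t) (F' t))).
  move=> mF mF'; apply: measurableT_comp mphi _.
  by apply: measurable_makespan mF mF'; exact: measurable_cst.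
pose G s := exp_means mu n.+1 (fun qs => phi (makespan 0 s qs)).
rewrite (exp_means_memoryless mu0 (n := l) (G := G)); first last.
- move=> d T y F my mF; rewrite /G.
  apply: (measurable_exp_means mu0 (G := fun t qs => phi (makespan 0 (F t) qs))) => //.
  move=> d' T' y' F' my' mF'; apply: (mphim _ _ l.+1 n.+1 (F \o y')) => //.
  exact: measurable_seq_comp.
- by move=> s s' ss'; apply: (eq_exp_means mu0) => // qs _ _; rewrite (makespan_perm _ _ ss').
- by move=> s; exact: (exp_means_ge0 mu0).
apply: eq_exp_mean => [|z z0]; first by rewrite mulr_gt0.
have mphiz : measurable_fun [set: R] (fun x => phi (z + x)%R).
  by apply: measurableT_comp mphi _; apply: measurable_funD.
transitivity (exp_means mu l.+1 (fun s => exp_means mu n (fun qs => phi (z + makespan 0 s qs)%R))); last first.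
  exact: (IHn (fun x => phi (z + x)%R)).
(* The service time [q] of the fetched task is integrated after the residual times [s] on the left
   and before them on the right, where it is one of the running tasks; Tonelli exchanges them. *)
change (exp_means mu l (fun s => exp_mean mu (fun q => exp_means mu n
  (fun qs => phi (makespan 0 (z :: translate z s) (q :: qs))))) =
  exp_mean mu (fun q => exp_means mu l (fun s => exp_means mu n (fun qs =>
    phi (z + makespan 0 (q :: s) qs)%R)))).
rewrite (exp_mean_exp_means_swap mu0)//.
- apply: (eq_exp_means mu0) => // s sl s0; apply: eq_exp_mean => // q q0.
  apply: (eq_exp_means mu0) => // qs _ qs0.
  congr phi; exact: makespan_cons_translate.
- by move=> q s; exact: (exp_means_ge0 mu0).
move=> d T y F my mF.
apply: (measurable_exp_means mu0
  (G := fun t qs => phi (z + makespan 0 (y t :: F t) qs)%R)) => //.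
move=> d' T' y' F' my' mF'; apply: measurableT_comp mphi _.
apply: measurable_funD; first exact: measurable_cst.
apply: (measurable_makespan (l := l.+1) (n := n)) => //.
constructor; first exact: measurableT_comp my my'.
exact: measurable_seq_comp.
Qed.

End MakespanLaw.

(** * Exponential moment and mean of a hypoexponential variable *)

Section HypoexpValues.
Local Open Scope ereal_scope.
Context {R : realType}.

(** Exponential tilting: the integrand is [r / (r - theta)] times the density of rate [r - theta].
    Negative [theta] is allowed, and serves for the mean. *)
Lemma exp_mean_expR (r theta : R) : (0 < r)%R -> (theta < r)%R ->
  exp_mean r (fun z => (expR (theta * z))%:E) = (r / (r - theta))%:E.
Proof.
move=> r0 tr; have rt0 : (0 < r - theta)%R by rewrite subr_gt0.
rewrite exp_meanE//; last first.
  by apply/measurable_EFinP/measurableT_comp => //; exact: mulrl_measurable.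
transitivity (\int[lebesgue_measure]_x
    ((r / (r - theta))%:E * (exponential_pdf (r - theta) x)%:E)).
  apply: eq_integral => x _; rewrite -!EFinM; congr _%:E.
  have [x0|x0] := ltP x 0%R; first by rewrite !lt0_exponential_pdf// !mulr0.
  rewrite !exponential_pdfE//= ger0_norm//.
  rewrite (_ : - (r - theta) * x = theta * x + - r * x)%R; last by ring.
  by rewrite expRD; field; lra.
rewrite ge0_integralZl_EFin//.
- by rewrite integral_exponential_pdf// mule1.
- by move=> x _; exact: exponential_pdf_ge0E.
- exact: measurable_exponential_pdfE.
- by rewrite divr_ge0// ltW.
Qed.

Lemma le_exp_mean (r : R) g h : (0 < r)%R ->
  measurable_fun [set: R] g -> (forall x, 0 <= g x) ->
  measurable_fun [set: R] h -> (forall x, 0 <= h x) ->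
  (forall x, (0 <= x)%R -> g x <= h x) -> exp_mean r g <= exp_mean r h.
Proof.
move=> r0 mg g0 mh h0 gh.
apply: (@ge0_le_integral _ _ _ (exponential_probability r0)) => //; try exact: measurable_fun_norm.
by move=> x _; exact: gh.
Qed.

(* [1 + theta z <= expR (theta z)] for positive and negative [theta] squeezes
   the mean between [1 / (r + theta)] and [1 / (r - theta)]. *)
Lemma exp_mean_norm (r : R) : (0 < r)%R -> exp_mean r (fun z => `|z|%:E) = r^-1%:E.
Proof.
move=> r0; set m := exp_mean r _.
have mn : measurable_fun [set: R] (fun z : R => `|z|%:E) by exact/measurable_EFinP.
have me (t : R) : measurable_fun [set: R] (fun z => (expR (t * z))%:E).
  by apply/measurable_EFinP/measurableT_comp => //; exact: mulrl_measurable.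
have e0 (t x : R) : 0 <= (expR (t * x))%:E by rewrite lee_fin expR_ge0.
have mt (t : R) : measurable_fun [set: R] (fun z : R => t%:E * `|z|%:E).
  by apply: emeasurable_funM => //; exact: measurable_cst.
have m1 : measurable_fun [set: R] (fun=> 1%:E : \bar R) by exact: measurable_cst.
have ub t : (0 < t)%R -> (t < r)%R -> 1 + t%:E * m <= (r / (r - t))%:E.
  move=> t0 tr; rewrite -exp_mean_expR// -exp_meanZl ?(ltW t0)// -(@exp_mean_cst _ r 1)//.
  rewrite -exp_meanD//; first last.
  - by move=> x; rewrite mule_ge0// lee_fin (ltW t0).
  apply: le_exp_mean => //.
  - exact: emeasurable_funD.
  - by move=> x; rewrite adde_ge0 ?mule_ge0 ?lee_fin ?ler01 ?(ltW t0).
  - by move=> x x0; rewrite -EFinM -EFinD lee_fin ger0_norm// expR_ge1Dx.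
have lb t : (0 < t)%R -> 1 <= (r / (r + t))%:E + t%:E * m.
  move=> t0; have -> : (r / (r + t) = r / (r - - t))%R by rewrite opprK.
  rewrite -exp_mean_expR//; last by lra.
  rewrite -exp_meanZl ?(ltW t0)// -{1}(@exp_mean_cst _ r 1)// -exp_meanD//; first last.
  - by move=> x; rewrite mule_ge0// lee_fin (ltW t0).
  apply: le_exp_mean => //.
  - exact: emeasurable_funD.
  - by move=> x; rewrite adde_ge0 ?mule_ge0 ?lee_fin ?ler01 ?(ltW t0).
  - move=> x x0; rewrite -EFinM -EFinD lee_fin ger0_norm//.
    by have := expR_ge1Dx (- t * x); lra.
have m0 : 0 <= m by exact: exp_mean_ge0.
(* An infinite mean contradicts the upper bound, say at [t = r / 2]. *)
move: m m0 ub lb => [m| |]// m0 ub lb; last first.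
  have r2 : (0 < r / 2)%R by rewrite divr_gt0.
  have r2r : (r / 2 < r)%R by lra.
  by have := ub _ r2 r2r; rewrite gt0_muley ?lte_fin// addey// leye_eq.
rewrite lee_fin in m0.
have {}ub t : (0 < t)%R -> (t < r)%R -> (m * (r - t) <= 1)%R.
  move=> t0 tr; have := ub t t0 tr; rewrite -EFinM -EFinD lee_fin.
  rewrite ler_pdivlMr ?subr_gt0// => H.
  by rewrite -(ler_pM2l t0); nra.
have {}lb t : (0 < t)%R -> (1 <= m * (r + t))%R.
  move=> t0; have := lb t t0; rewrite -EFinM -EFinD lee_fin -lerBlDl.
  have rt : (0 < r + t)%R by rewrite addr_gt0.
  have -> : (1 - r / (r + t) = t / (r + t))%R by field; lra.
  by rewrite ler_pdivrMr// -mulrA -{1}(mulr1 t) ler_pM2l.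
congr _%:E; apply: (mulIf (lt0r_neq0 r0)); rewrite mulVf ?gt_eqF//.
apply/le_anti/andP; split; rewrite leNgt; apply/negP => H.
  have m_gt0 : (0 < m)%R
    by rewrite lt_neqAle m0 andbT; apply/eqP => mm; move: H; rewrite -mm mul0r ltr10.
  (* If [m * r > 1], the upper bound asks for [m * t >= m * r - 1]; this [t] gives half of it. *)
  have := ub ((m * r - 1) / (2 * m))%R.
  rewrite divr_gt0 ?mulr_gt0 ?subr_gt0// ltr_pdivrMr ?mulr_gt0//.
  have -> : (m * (r - (m * r - 1) / (2 * m)) = (m * r + 1) / 2)%R by field; lra.
  move=> /(_ isT) K; have := K _.
  by have : (m * r - 1 < r * (2 * m))%R; nra.
(* If [m * r < 1], the lower bound asks for [m * t >= 1 - m * r]; this [t] gives at most half of it.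
   The denominator has [m + 1] since [m] may be 0 here. *)
have := lb ((1 - m * r) / (2 * (m + 1)))%R.
rewrite divr_gt0 ?mulr_gt0 ?subr_gt0 ?ltr_wpDl// => /(_ isT).
have : (m * ((1 - m * r) / (2 * (m + 1))) <= (1 - m * r) / 2)%R.
  rewrite mulrA ler_pdivrMr ?mulr_gt0 ?ltr_wpDl//; nra.
by rewrite mulrDr; lra.
Qed.

(** The factor [c] makes the induction pass: it collects [expR (theta * z)] for the variables
    already fixed. *)
Lemma hypoexp_expR rs (theta c : R) : (0 <= c)%R ->
  all (fun r => (0 < r) && (theta < r))%R rs ->
  hypoexp rs (fun x => (c * expR (theta * x))%:E) =
  (c * \prod_(r <- rs) (r / (r - theta)))%:E.
Proof.
elim: rs c => [|r rs IH] c c0 /=; first by rewrite mulr0 expR0 big_nil.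
move=> /andP[/andP[r0 tr] rs0].
rewrite big_cons; set p := (\prod_(r <- rs) _)%R.
have p0 : (0 <= p)%R.
  rewrite /p big_seq prodr_ge0// => s /(allP rs0)/andP[s0 ts].
  by rewrite divr_ge0 ?subr_ge0; lra.
transitivity (exp_mean r (fun z => (c * p)%:E * (expR (theta * z))%:E)).
  apply: eq_exp_mean => // z z0.
  transitivity (hypoexp rs (fun x => (c * expR (theta * z) * expR (theta * x))%:E)).
    apply: eq_hypoexp; first by apply: sub_all rs0 => s /andP[].
    by move=> x _; rewrite mulrDr expRD mulrA.
  by rewrite IH ?mulr_ge0 ?expR_ge0// -EFinM mulrAC.
rewrite exp_meanZl ?mulr_ge0//; last first.
  by apply/measurable_EFinP/measurableT_comp => //; exact: mulrl_measurable.
rewrite exp_mean_expR// -EFinM; congr EFin; rewrite -[LHS]mulrA; congr (c * _)%R; exact: mulrC.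
Qed.

(** As above, [c] collects the variables already fixed. The absolute value makes the integrand
    nonnegative on the whole line and changes nothing at nonnegative reals. *)
Lemma hypoexp_norm rs (c : R) : (0 <= c)%R -> all (fun r => 0 < r)%R rs ->
  hypoexp rs (fun x => `|c + x|%:E) = (c + \sum_(r <- rs) r^-1)%:E.
Proof.
elim: rs c => [|r rs IH] c c0 /=; first by move=> _; rewrite big_nil !addr0 ger0_norm.
move=> /andP[r0 rs0].
rewrite big_cons; set p := (\sum_(r <- rs) _)%R.
have p0 : (0 <= p)%R.
  by rewrite /p big_seq sumr_ge0// => s /(allP rs0) s0; rewrite invr_ge0 ltW.
transitivity (exp_mean r (fun z => (c + p)%:E + `|z|%:E)).
  apply: eq_exp_mean => // z z0.
  transitivity (hypoexp rs (fun x => `|c + z + x|%:E)).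
    by apply: eq_hypoexp => // x _; rewrite addrA.
  by rewrite IH ?addr_ge0// -EFinD ger0_norm// addrAC.
have mn : measurable_fun [set: R] (fun z : R => `|z|%:E) by exact/measurable_EFinP.
rewrite exp_meanD//; last by move=> x; rewrite lee_fin addr_ge0.
rewrite exp_mean_cst// exp_mean_norm// -EFinD; by rewrite -addrA [(p + _)%R]addrC.
Qed.

End HypoexpValues.

(** * From independence to iterated integrals *)

Section Independence.
Local Open Scope ereal_scope.
Context {d} {T : measurableType d} {R : realType} (P : probability T R).

(** Measurable rectangles are stable under intersection and generate the product sigma-algebra. *)
Lemma joint_law_unique d1 d2 (T1 : measurableType d1) (T2 : measurableType d2)
    (m m' : {measure set (T1 * T2) -> \bar R}) : m setT < +oo ->
  (forall A B, measurable A -> measurable B -> m (A `*` B) = m' (A `*` B)) ->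
  forall X, measurable X -> m X = m' X.
Proof.
move=> moo mm X mX.
pose C : set (set (T1 * T2)) := [set A `*` B | A in measurable & B in measurable].
apply: (measure_unique C (fun=> setT)) => //.
- exact: measurable_prod_measurableType.
- move=> _ _ [A1 mA1 [A2 mA2 <-]] [B1 mB1 [B2 mB2 <-]]; rewrite -setXI.
  exists (A1 `&` B1); first exact: measurableI.
  by exists (A2 `&` B2) => //; exact: measurableI.
- by move=> n; exists setT => //; exists setT => //; rewrite setXTT.
- by rewrite bigcup_const//; exists 0%N.
- by move=> _ [A mA [B mB <-]]; exact: mm.
Qed.

Variables (mu : R) (mu0 : (0 < mu)%R).

Fixpoint cylinder n (X : nat -> T -> R) (B : nat -> set R) : set T :=
  if n is n'.+1 then (X 0%N @^-1` B 0%N) `&` cylinder n' (X \o S) (B \o S) else setT.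

Lemma measurable_cylinder n (X : nat -> T -> R) B :
  (forall i, measurable_fun [set: T] (X i)) -> (forall i, measurable (B i)) ->
  measurable (cylinder n X B).
Proof.
elim: n X B => [|n IHn] X B mX mB /=; first exact: measurableT.
apply: measurableI.
  by rewrite -[X in measurable X]setTI; exact: mX.
by apply: IHn => i; [exact: mX|exact: mB].
Qed.

(** A single formula for three facts: the variables [X i], [i < n], are exponential of rate [mu],
    independent of each other, and jointly independent of [Y]. *)
Definition exponential_family d' (T' : measurableType d') (Y : T -> T') n
    (X : nat -> T -> R) :=
  forall A B, measurable A -> (forall i, measurable (B i)) ->
  P (Y @^-1` A `&` cylinder n X B) =
  P (Y @^-1` A) * \prod_(i < n) exponential_prob mu (B i).

Lemma exponential_family_law d' (T' : measurableType d') (Y : T -> T') X n :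
  measurable_fun [set: T] Y -> (forall i, measurable_fun [set: T] (X i)) ->
  exponential_family Y n.+1 X ->
  forall A B, measurable A -> measurable B ->
  P ((Y @^-1` A) `&` (X 0%N @^-1` B)) = P (Y @^-1` A) * exponential_prob mu B.
Proof.
move=> mY mX ind A B mA mB.
have := ind A (fun i => if i is 0%N then B else setT) mA.
have cT m (Z : nat -> T -> R) : cylinder m Z (fun=> setT) = setT.
  by elim: m Z => [//|m IHm] Z /=; rewrite preimage_setT setTI; exact: IHm.
rewrite [cylinder _ _ _]/= [cylinder n _ _]cT setIT big_ord_recl/= => -> //.
  rewrite big1 ?mule1// => i _.
  exact: (@probability_setT _ _ _ (exponential_probability mu0)).
by case.
Qed.

(* The variables [X i] are integrated out one at a time: the first one is moved
   to the conditioning variable, [Y] becoming [(Y, X 0)]. *)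
Lemma integral_exponential_family n : forall d' (T' : measurableType d') (Y : T -> T')
    (X : nat -> T -> R) (G : T' -> seq R -> \bar R),
  measurable_fun [set: T] Y -> (forall i, measurable_fun [set: T] (X i)) ->
  (forall i w, 0 <= X i w)%R ->
  exponential_family Y n X ->
  (forall t s, 0 <= G t s) -> measurable_functional n G ->
  \int[P]_w G (Y w) (mkseq (X ^~ w) n) = \int[P]_w exp_means mu n (G (Y w)).
Proof.
elim: n => [//|n IHn] d' T' Y X G mY mX X0 ind G0 mG.
pose Y' w := (Y w, X 0%N w).
have mY' : measurable_fun [set: T] Y' by exact: measurable_fun_pair.
have law := exponential_family_law mY mX ind.
have ind' : exponential_family Y' n (X \o S).
  move=> A' B mA' mB.
  have mC : measurable (cylinder n (X \o S) B) by apply: measurable_cylinder => // i; exact: mX.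
  pose c : R := (\prod_(i < n) fine (exponential_prob mu (B i)))%R.
  have c0 : (0 <= c)%R.
    by apply: prodr_ge0 => i _; change (0 <= fine (exponential_probability mu0 (B i)))%R; rewrite fine_ge0.
  have cE : \prod_(i < n) exponential_prob mu (B i) = c%:E.
    rewrite /c -prodEFin; apply: eq_bigr => i _.
    change (exponential_probability mu0 (B i) =
      (fine (exponential_probability mu0 (B i)))%:E).
    by rewrite fineK//; apply: fin_num_measure; exact: mB.
  (* Both sides are measures of [A']: the law of [(Y, X 0)] restricted to the cylinder event, and
     the same law scaled by [c]. It suffices to compare them on rectangles, where the hypothesis on
     [Y] applies. *)
  pose m1 : {measure set (T' * R) -> \bar R} :=
    measure_function_pushforward__canonical__measure_function_Measure (mrestr P mC) mY'.
  pose m2 : {measure set (T' * R) -> \bar R} := mscale (NngNum c0)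
    (measure_function_pushforward__canonical__measure_function_Measure P mY').
  rewrite cE muleC; change (m1 A' = m2 A').
  apply: joint_law_unique => //.
    change (P (setT `&` cylinder n (X \o S) B) < +oo).
    by rewrite setTI (le_lt_trans (probability_le1 P mC)) ?ltry.
  move=> A0 B0 mA0 mB0.
  change (P (Y @^-1` A0 `&` X 0%N @^-1` B0 `&` cylinder n (X \o S) B) =
    c%:E * P (Y @^-1` A0 `&` X 0%N @^-1` B0)).
  rewrite law// muleC -cE -muleA -setIA.
  rewrite (ind A0 (fun i => if i is i'.+1 then B i' else B0))//; last by case.
  by rewrite big_ord_recl.
pose G' (p : T' * R) s := G p.1 (p.2 :: s).
transitivity (\int[P]_w G' (Y' w) (mkseq ((X \o S) ^~ w) n)).
  by apply: eq_integral => w _; rewrite /G' /mkseq/= (iotaDl 1 0) -map_comp.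
rewrite (IHn _ _ Y' _ G')//; last exact: measurable_functional_cons.
(* The absolute value matches the one in [exp_mean], and is invisible along [Y'] because [X 0] is
   nonnegative. *)
pose H (p : T' * R) := exp_means mu n (G' (p.1, `|p.2|%R)).
have H0 p : 0 <= H p by apply: (exp_means_ge0 mu0) => s; exact: G0.
have mH : measurable_fun [set: T' * R] H.
  have mn : measurable_fun [set: T' * R] (fun p : T' * R => (p.1, `|p.2|)%R).
    by apply: measurable_fun_pair => //; exact: measurableT_comp.
  have := measurable_exp_means mu0 (fun t s => G0 t.1 (t.2 :: s)) (measurable_functional_cons mG).
  by move=> mi; exact: measurableT_comp mi mn.
pose Ym : {mfun T >-> T'} := HB.pack Y (isMeasurableFun.Build _ _ _ _ Y mY).
pose TR : measurableType _ := (T' * measurableTypeR R)%type.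
have mTR : @measurable_fun _ _ T TR setT Y'.
  exact: (@measurable_fun_pair _ _ _ _ _ (measurableTypeR R) _ _ mY (mX 0%N)).
pose Ym' : {mfun T >-> TR} := HB.pack Y' (isMeasurableFun.Build _ _ T TR Y' mTR).
transitivity (\int[P]_w H (Y' w)).
  by apply: eq_integral => w _; rewrite /H /= ger0_norm.
transitivity (\int[distribution P Ym']_p H p).
  by rewrite ge0_integral_distribution.
(* Independence of [Y] and [X 0] identifies their joint law with the product law; Tonelli then
   integrates out [X 0]. *)
transitivity (\int[distribution P Ym \x exponential_probability mu0]_p H p).
  apply: eq_measure_integral => A mA _; apply/esym.
  apply: product_measure_unique => // A0 B0 mA0 mB0; exact: law.
rewrite fubini_tonelli1// ge0_integral_distribution//.
- exact: measurable_fun_fubini_tonelli_F.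
- by move=> y; apply: integral_ge0 => x _; exact: H0.
- by move=> i; exact: mX.
- by move=> i w; exact: X0.
- by move=> t s; exact: G0.
Qed.

End Independence.

(** * One job, and several successive jobs *)

Section Jobs.
Local Open Scope ereal_scope.
Context {R : realType}.

Lemma measurable_seq_inv d (T : measurableType d) n (F : T -> seq R) :
  measurable_seq n F -> if n is n'.+1 then
    exists f F', [/\ measurable_fun [set: T] f, measurable_seq n' F' &
      F = fun t => f t :: F' t] else F = fun=> [::].
Proof. by case=> [//|{}n f {}F mf mF]; exists f, F. Qed.

Lemma measurable_seq_split d (T : measurableType d) n m (F : T -> seq R) :
  measurable_seq (n + m) F ->
  measurable_seq n (fun t => take n (F t)) /\ measurable_seq m (fun t => drop n (F t)).
Proof.
elim: n F => [|n IHn] F mF.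
  under eq_fun do rewrite take0; under [X in _ /\ measurable_seq _ X]eq_fun do rewrite drop0.
  by split => //; exact: measurable_nil.
have [f [F' [mf mF' ->]]] := measurable_seq_inv mF.
have [mt md] := IHn _ mF'; split => //=.
exact: (measurable_seq_cons (f := f) (F := fun t => take n (F' t))).
Qed.

Lemma measurable_job_time d (T : measurableType d) l k (F : T -> seq R) :
  (l <= k)%N -> measurable_seq k F -> measurable_fun [set: T] (fun t => job_time l (F t)).
Proof.
move=> lk; rewrite -(subnKC lk) => /measurable_seq_split[mt md].
by apply: measurable_makespan mt md; exact: measurable_cst.
Qed.

Definition job_rates l k (mu : R) :=
  (nseq (k - l) (l%:R * mu) ++ [seq i%:R * mu | i <- rev (iota 1 l)])%R.

Variables (mu : R) (mu0 : (0 < mu)%R).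

Lemma exp_means_job_time l k phi : (0 < l)%N -> (l <= k)%N ->
  measurable_fun [set: R] phi -> (forall x, 0 <= phi x) ->
  exp_means mu k (fun s => phi (job_time l s)) = hypoexp (job_rates l k mu) phi.
Proof.
move=> l0 lk mphi phi0; rewrite /job_rates -(exp_means_makespan mu0 (k - l) l0 mphi phi0).
rewrite -[in LHS](subnKC lk) (exp_means_cat mu0).
apply: (eq_exp_means mu0) => s sl _; apply: (eq_exp_means mu0) => qs _ _.
by rewrite /job_time take_size_cat// drop_size_cat.
Qed.

(** The exponential of [theta] times the total service time of [n] jobs, read from one list cut into
    blocks of [k]. The product form lets the iterated integral factor block by block. *)
Fixpoint jobs_exp (theta : R) l k n (s : seq R) : R :=
  if n is n'.+1 then
    (expR (theta * job_time l (take k s)) * jobs_exp theta l k n' (drop k s))%R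
  else 1%R.

Lemma jobs_exp_ge0 theta l k n s : (0 <= jobs_exp theta l k n s)%R.
Proof. by elim: n s => [//|n IHn] s /=; rewrite mulr_ge0 ?expR_ge0. Qed.

Lemma measurable_jobs_exp d (T : measurableType d) theta l k n (F : T -> seq R) :
  (l <= k)%N -> measurable_seq (n * k) F ->
  measurable_fun [set: T] (fun t => jobs_exp theta l k n (F t)).
Proof.
move=> lk; elim: n F => [|n IHn] F; first by move=> _; exact: measurable_cst.
rewrite mulSn => /measurable_seq_split[mt md]; apply: measurable_funM; last exact: IHn.
apply: measurableT_comp => //; apply: measurable_funM; first exact: measurable_cst.
exact: measurable_job_time mt.
Qed.

Lemma exp_means_jobs_exp theta l k n (M : R) : (l <= k)%N -> (0 <= M)%R ->
  exp_means mu k (fun s => (expR (theta * job_time l s))%:E) = M%:E ->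
  exp_means mu (n * k) (fun s => (jobs_exp theta l k n s)%:E) = (M ^+ n)%:E.
Proof.
move=> lk M0 ME; elim: n => [//|n IHn]; rewrite mulSn (exp_means_cat mu0).
have mjobs : measurable_functional (n * k) (fun _ : unit => fun s => (jobs_exp theta l k n s)%:E).
  by move=> d T y F my mF; apply/measurable_EFinP; exact: measurable_jobs_exp.
transitivity (exp_means mu k (fun s => (M ^+ n)%:E * (expR (theta * job_time l s))%:E)).
  apply: (eq_exp_means mu0) => s sk _; rewrite muleC -IHn -(exp_meansZl mu0) ?expR_ge0//; last first.
    by move=> s'; rewrite lee_fin jobs_exp_ge0.
  apply: (eq_exp_means mu0) => s' _ _ /=.
  by rewrite take_size_cat// drop_size_cat.
rewrite (exp_meansZl mu0) ?exprn_ge0//.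
- by rewrite ME -EFinM exprSr.
- move=> d T y F my mF; apply/measurable_EFinP/measurableT_comp => //.
  apply: measurable_funM; first exact: measurable_cst.
  exact: measurable_job_time mF.
Qed.

End Jobs.

(** * Finite sequences drawn from an iid exponential family *)

Section IidFamily.
Local Open Scope ereal_scope.
Context {d} {T : measurableType d} {R : realType} (P : probability T R).

Lemma cylinderE n (X : nat -> T -> R) B :
  cylinder n X B = \bigcap_(i in `I_n) (X i @^-1` B i).
Proof.
elim: n X B => [|n IHn] X B /=; first by rewrite II0 bigcap_set0.
rewrite IHn; apply/seteqP; split => w.
  by move=> [X0 XS] [_ //|i] /= i_n; exact: XS.
by move=> Xw; split=> [|i i_n]; [exact: (Xw 0%N)|exact: (Xw i.+1)].
Qed.

Lemma iid_exponential_family (I : choiceType) (J : set I) (X : I -> {RV P >-> R})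
    (mu : R) (idx : nat -> I) n : iid_exponential J X mu ->
  {in [pred i | i < n]%N &, injective idx} -> (forall i, J (idx i)) ->
  exponential_family P mu (fun=> tt) n (fun i => X (idx i)).
Proof.
move=> [ind law] idxI Jidx A B _ mB.
have cylP : P (cylinder n (fun i => X (idx i)) B) =
    \prod_(i < n) exponential_prob mu (B i).
  pose r := [seq idx i | i <- iota 0 n].
  have ur : uniq r.
    by rewrite map_inj_in_uniq ?iota_uniq// => i j; rewrite !mem_iota => ? ?; exact: idxI.
  have indexr i : (i < n)%N -> index (idx i) r = i.
    move=> i_n; rewrite -[X in index X _](_ : nth (idx 0%N) r i = idx i).
      by rewrite index_uniq// size_map size_iota.
    by rewrite (nth_map 0%N) ?size_iota// nth_iota.
  pose s := [fset x in r]%fset.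
  (* Independence takes sets indexed by [I]: [B i] is attached to [idx i], its rank being recovered
     by [index], thanks to injectivity. *)
  have := ind s (fun x => B (index x r)) _ (fun x => mB _).
  rewrite (_ : \bigcap_(x in [set` s]) _ = cylinder n (fun i => X (idx i)) B); last first.
    rewrite cylinderE; apply/seteqP; split => w Xw.
      move=> i /= i_n; have := Xw (idx i); rewrite /= indexr//; apply.
      by rewrite !inE; apply: map_f; rewrite mem_iota.
    move=> x /=; rewrite !inE => /mapP[i]; rewrite mem_iota => /andP[_ i_n] ->.
    by rewrite indexr//; exact: Xw.
  move=> ->.
    rewrite (perm_big r)/=; last first.
      by apply: uniq_perm => // x; rewrite !inE.
    rewrite big_map -[in LHS](subn0 n) -/(index_iota 0 n) big_mkord.
    by apply: eq_bigr => i _; rewrite indexr//; exact: law.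
  by move=> x /=; rewrite !inE => /mapP[i _ ->].
have [Att|At] := pselect (A tt).
  rewrite (_ : _ @^-1` A = setT); last by apply/seteqP; split.
  by rewrite setTI probability_setT mul1e.
rewrite (_ : _ @^-1` A = set0); last by apply/seteqP; split.
by rewrite set0I measure0 mul0e.
Qed.

End IidFamily.

(** * All tasks from job [m] on as one sequence, job after job *)

Section TaskEnumeration.
Context {R : realType} (l k : nat) (k_gt0 : (0 < k)%N).

Definition task m (i : nat) : 'I_k * nat :=
  (Ordinal (ltn_pmod i k_gt0), (m + i %/ k)%N).

Lemma task_inj m : injective (task m).
Proof.
move=> i j [ij /addnI eij].
by rewrite (divn_eq i k) (divn_eq j k) ij eij.
Qed.

Lemma mkseq_task (q : 'I_k -> nat -> R) m n :
  mkseq (fun i => q (task m i).1 (task m i).2) (k + n) =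
  [seq q i m | i <- enum 'I_k] ++ mkseq (fun i => q (task m.+1 i).1 (task m.+1 i).2) n.
Proof.
rewrite /mkseq iotaD map_cat; congr (_ ++ _).
  rewrite -(val_enum_ord k) -map_comp; apply: eq_map => i /=.
  rewrite divn_small// addn0; congr (q _ m).
  by apply: val_inj; rewrite /= modn_small.
rewrite add0n -[in iota k n](addn0 k) iotaDl -map_comp; apply: eq_map => i /=.
rewrite divnDl// divnn k_gt0 addSnnS; congr (q _ _).
by apply: val_inj; rewrite /= modnDl.
Qed.

Lemma jobs_exp_task (q : 'I_k -> nat -> R) (theta : R) m n :
  jobs_exp theta l k n (mkseq (fun i => q (task m i).1 (task m i).2) (n * k)) =
  expR (theta * \sum_(m <= nu < m + n) job_time l [seq q i nu | i <- enum 'I_k]).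
Proof.
elim: n m => [|n IHn] m; first by rewrite addn0 big_geq// mulr0 expR0.
rewrite mulSn mkseq_task; cbn [jobs_exp].
have qk : size [seq q i m | i <- enum 'I_k] = k by rewrite size_map size_enum_ord.
rewrite (take_size_cat _ qk) (drop_size_cat _ qk) IHn addSnnS [in RHS]big_ltn ?addnS ?ltnS ?leq_addr//.
by rewrite mulrDr expRD.
Qed.

End TaskEnumeration.

(** * Expectations over the sample space *)

Section JobLaw.
Local Open Scope ereal_scope.
Context {d} {T : measurableType d} {R : realType} (P : probability T R).
Variables (l k : nat) (l_gt0 : (0 < l)%N) (lk : (l <= k)%N).
Variables (Q : 'I_k -> nat -> {RV P >-> R}) (mu : R).
Hypotheses (mu0 : (0 < mu)%R) (Q0 : forall i n w, (1 <= n)%N -> (0 <= Q i n w)%R).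
Hypothesis iidQ :
  iid_exponential [set x : 'I_k * nat | (1 <= x.2)%N] (fun x => Q x.1 x.2) mu.

Let k_gt0 : (0 < k)%N := leq_trans l_gt0 lk.

(** The conditioning variable starts as the constant [tt], so what remains under the expectation is
    a constant. *)
Lemma expectation_tasks m N (G : seq R -> \bar R) : (1 <= m)%N ->
  (forall s, 0 <= G s) -> measurable_functional N (fun _ : unit => G) ->
  \int[P]_w G (mkseq (fun i => Q (task k_gt0 m i).1 (task k_gt0 m i).2 w) N) = exp_means mu N G.
Proof.
move=> m1 G0 mG.
have Jtask i : [set x : 'I_k * nat | (1 <= x.2)%N] (task k_gt0 m i).
  by rewrite /= ltn_addr.
have ind := iid_exponential_family iidQ (in2W (@task_inj k k_gt0 m)) Jtask.
rewrite (integral_exponential_family mu0 (Y := fun=> tt) (G := fun _ => G)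
  (X := fun i w => Q (task k_gt0 m i).1 (task k_gt0 m i).2 w))//.
- by rewrite integral_cst// -[RHS]mule1; congr (_ * _); exact: probability_setT.
- by move=> i w; apply: Q0; rewrite /= ltn_addr.
Qed.

Lemma expectation_job_time n phi : (1 <= n)%N ->
  measurable_fun [set: R] phi -> (forall x, 0 <= phi x) ->
  \int[P]_w phi (job_time l [seq Q i n w | i <- enum 'I_k]) =
  hypoexp (job_rates l k mu) phi.
Proof.
move=> n1 mphi phi0; rewrite -exp_means_job_time// -(@expectation_tasks n)//.
  apply: eq_integral => w _; have := mkseq_task k_gt0 (fun i n => Q i n w) n 0.
  by rewrite addn0 cats0 => ->.
move=> d' T' y F my mF; apply: measurableT_comp mphi _.
exact: measurable_job_time mF.
Qed.

Lemma expectation_expR_jobs theta m n (M : R) : (1 <= m)%N -> (0 <= M)%R ->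
  hypoexp (job_rates l k mu) (fun x => (expR (theta * x))%:E) = M%:E ->
  \int[P]_w (expR (theta * \sum_(m <= nu < m + n)
     job_time l [seq Q i nu w | i <- enum 'I_k]))%:E = (M ^+ n)%:E.
Proof.
move=> m1 M0 ME; rewrite -(@exp_means_jobs_exp _ mu mu0 theta l k n M)//; last first.
  rewrite -ME (@exp_means_job_time _ mu mu0 l k (fun x => (expR (theta * x))%:E))//.
  by apply/measurable_EFinP/measurableT_comp => //; exact: mulrl_measurable.
rewrite -(@expectation_tasks m)//.
- by apply: eq_integral => w _; rewrite (jobs_exp_task l k_gt0 (fun i n => Q i n w)).
- by move=> s; rewrite lee_fin jobs_exp_ge0.
- by move=> d' T' y F my mF; apply/measurable_EFinP; exact: measurable_jobs_exp.
Qed.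

End JobLaw.

(** * Closed forms for the rates *)

Section Rates.
Context {R : realType}.

(** The smallest rate is [mu], that of the last running task, whence the range [theta < mu]. *)
Lemma job_rates_gt0 l k (mu theta : R) : 0 < mu -> theta < mu ->
  (0 < l)%N -> all (fun r => (0 < r) && (theta < r)) (job_rates l k mu).
Proof.
move=> mu0 tmu l0; have ok i : (0 < i)%N -> (0 < i%:R * mu) && (theta < i%:R * mu).
  move=> i0; rewrite mulr_gt0 ?ltr0n//=; apply: (lt_le_trans tmu).
  by rewrite ler_peMl ?ler1n// ltW.
rewrite all_cat; apply/andP; split; first by rewrite all_nseq ok ?orbT.
apply/allP => _ /mapP[i + ->]; rewrite mem_rev mem_iota => /andP[i0 _]; exact: ok.
Qed.

Lemma prod_job_rates l k (mu theta : R) : 0 < mu -> 0 < theta < mu -> (0 < l)%N ->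
  \prod_(r <- job_rates l k mu) (r / (r - theta)) =
  expR (theta * (rho_X l mu theta + (k - l)%:R * rho_Z l mu theta)).
Proof.
move=> mu0 /andP[t0 tmu] l0; have rpos i : (0 < i)%N ->
    0 < i%:R * mu / (i%:R * mu - theta).
  move=> i0; have imu : mu <= i%:R * mu by rewrite ler_peMl ?ler1n// ltW.
  by rewrite divr_gt0 ?subr_gt0 ?(lt_le_trans tmu)// (lt_le_trans mu0).
rewrite /job_rates big_cat/= big_nseq big_map (perm_big (iota 1 l)) ?perm_rev//=.
rewrite mulrDr expRD mulrC /rho_X /rho_Z mulVKf ?gt_eqF//; congr (_ * _).
  rewrite expR_sum /index_iota subSS subn0 [LHS]big_seq [RHS]big_seq.
  apply: eq_bigr => i; rewrite mem_iota => /andP[i0 _].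
  by rewrite lnK// posrE rpos.
rewrite mulrCA mulVKf ?gt_eqF// [X in expR X]mulrC expRM_natr lnK ?posrE ?rpos//.
by rewrite -Monoid.iteropE.
Qed.

(** Up to the factor [mu^-1], the queue contributes [(k - l) / l]; the term [i = 1] of the harmonic
    sum completes it to [k / l]. *)
Lemma sum_job_rates l k (mu : R) : 0 < mu -> (0 < l)%N -> (l <= k)%N ->
  \sum_(r <- job_rates l k mu) r^-1 =
  mu^-1 * (k%:R / l%:R + \sum_(2 <= i < l.+1) i%:R^-1).
Proof.
move=> mu0 l0 lk.
rewrite /job_rates big_cat/= big_nseq big_map (perm_big (iota 1 l)) ?perm_rev//=.
rewrite (_ : iota 1 l = index_iota 1 l.+1); last by rewrite /index_iota subSS subn0.
rewrite big_ltn// iter_addr_0 -[X in X + _]mulr_natr natrB//.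
under eq_bigr do rewrite invfM mulrC.
rewrite -big_distrr/= mul1r; set s := \sum_(_ <= _ < _) _.
have l0' : l%:R != 0 :> R by rewrite pnatr_eq0 -lt0n.
by field; rewrite l0' gt_eqF.
Qed.

End Rates.

Lemma job_serviceE (R : realType) l k (A D : nat -> R) (Q : 'I_k -> nat -> R) n :
  (l <= k)%N -> split_merge l A D Q -> (1 <= n)%N ->
  job_service A D n = job_time l [seq Q i n | i <- enum 'I_k].
Proof.
move=> lk sys n1; rewrite /job_service.
rewrite [D n](job_departureE lk _ (departure_job sys n1)).
  by rewrite addrC addKr.
by move=> i; exact: (task_service_ge0 sys).
Qed.

Theorem lemma1 (R : realType) (d : measure_display) (T : measurableType d)
    (P : probability T R) (l k : nat) (hl : (1 <= l)%N) (hlk : (l <= k)%N)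
    (A D : nat -> T -> R) (Q : 'I_k -> nat -> {RV P >-> R})
    (hsys : forall w : T,
      split_merge l (fun n => A n w) (fun n => D n w) (fun i n => Q i n w)) :
  let Delta n w := job_service (fun j => A j w) (fun j => D j w) n in
  let S m n w := service_process (fun j => Delta j w) m n in
  (forall w : T,
     max_plus_server (fun n => A n w) (fun n => D n w) (fun m n => S m n w)) /\
  (forall mu : R, 0 < mu ->
     iid_exponential [set x : 'I_k * nat | (1 <= x.2)%N]
       (fun x => Q x.1 x.2) mu ->
     has_envelope_rate P `]0, mu[ S
       (fun theta => rho_X l mu theta + (k - l)%N%:R * rho_Z l mu theta) /\
     forall n, (1 <= n)%N ->
       ('E_P[Delta n])%E =
       (mu^-1 * (k%:R / l%:R + \sum_(2 <= i < l.+1) i%:R^-1))%:E).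
Proof.
move=> Delta S; split=> [w|mu mu0 iidQ]; first exact: split_merge_max_plus (hsys w).
have Q0 i n w : (1 <= n)%N -> 0 <= Q i n w by exact: (task_service_ge0 (hsys w)).
have DeltaE n w : (1 <= n)%N -> Delta n w = job_time l [seq Q i n w | i <- enum 'I_k].
  by move=> n1; rewrite /Delta (job_serviceE hlk (hsys w) n1).
split=> [m n theta m1 mn|n n1].
  rewrite /= in_itv/= => /andP[t0 tmu].
  have prodE := prod_job_rates k mu0 (introT andP (conj t0 tmu)) hl.
  set rho := (_ + _ * _) in prodE *.
  rewrite expRM_natr -(@expectation_expR_jobs _ _ _ P l k hl hlk Q mu mu0 Q0 iidQ theta m)//.
  (* The envelope bound holds with equality: [S m n] adds the service times of [n - m + 1] jobs,
     counted from job [m]. *)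
  - rewrite /mmt_gen_fun unlock le_eqVlt; apply/orP; left; apply/eqP.
    apply: eq_integral => w _ /=; rewrite mulrC /S /service_process.
    congr (expR (_ * _))%:E; rewrite addn1 -subSn// subnKC ?leqW//.
    by apply: eq_big_nat => nu /andP[mnu _]; rewrite DeltaE// (leq_trans m1).
  - have := hypoexp_expR ler01 (job_rates_gt0 k mu0 tmu hl).
    rewrite mul1r prodE => <-.
    by congr hypoexp; apply/funext => x; rewrite mul1r.
rewrite unlock -sum_job_rates//.
(* The job time is nonnegative, so the absolute value is harmless; the form [0 + _] is that of
   [hypoexp_norm] with [c = 0]. *)
transitivity (\int[P]_w (`|0 + job_time l [seq Q i n w | i <- enum 'I_k]|%:E))%E.
  apply: eq_integral => w _; rewrite DeltaE// add0r ger0_norm//.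
  exact: makespan_ge.
rewrite (@expectation_job_time _ _ _ P l k hl hlk Q mu mu0 Q0 iidQ n (fun x => `|0 + x|%:E))//.
  rewrite hypoexp_norm// ?add0r//.
  (* Positivity of the rates is the case [theta = 0]. *)
  by apply: sub_all (job_rates_gt0 k mu0 mu0 hl) => r /andP[].
by apply/measurable_EFinP/measurableT_comp => //; exact: measurable_funD.
Qed.
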